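(* Let $\mathcal P\subseteq\mathbb R^n$ be a full-dimensional convex polytope with face poset $P=\mathscr F(\mathcal P)$, and let $\mathcal P^*$ be its polar dual. Let $\operatorname{DStell}(\mathcal P^* )$ be the polytope (well defined up to combinatorial equivalence) obtained by taking the pyramid $\operatorname{Pyr}(\mathcal P^* )$ over $\mathcal P^*$ and then performing stellar subdivisions at all proper faces of $\operatorname{Pyr}(\mathcal P^* )$ not contained in the base, in decreasing order of dimension. Then there is an isomorphism of posets $$\operatorname{Stell}(P)\cong\mathscr F\bigl(\operatorname{DStell}(\mathcal P^* )\bigr).$$
   Context: The face poset $\mathscr F(\mathcal Q)$ of a polytope $\mathcal Q$ is the set of all faces, including $\emptyset$ and $\mathcal Q$, ordered by inclusion. The polar dual $\mathcal P^*$ is taken after translating $\mathcal P$ so that the origin lies in its interior; only its combinatorial type matters, and $\mathscr F(\mathcal P^* )$ is the order dual of $\mathscr F(\mathcal P)$. Stellahedral transform: for a poset $P$ with minimum $\widehat 0$, $$\operatorname{Stell}(P)=\{(c,y): c=\{\widehat 0=c_0<c_1<\dots<c_k\}\text{ a chain in }P \ (k\ge 0),\ y\in P,\ c_k\le y\}\sqcup\{\widehat 1_{\operatorname{Stell}}\},$$ where $\widehat 1_{\operatorname{Stell}}$ is a maximum element and $(c,y)\le(c',y')$ if and only if $c\subseteq c'$ and $y\ge y'$ in $P$. Stellar subdivision: let $\mathcal Q\subseteq\mathbb R^m$ be an $m$-dimensional polytope and $F$ a face. A point $v$ is beyond $F$ if for every facet $G$ of $\mathcal Q$ containing $F$ the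 point $v$ lies in the open half-space bounded by $\operatorname{aff}(G)$ opposite to $\mathcal Q$, and for every facet $G$ not containing $F$ it lies in the open half-space bounded by $\operatorname{aff}(G)$ that contains the interior of $\mathcal Q$. The stellar subdivision of $\mathcal Q$ at a nonempty proper face $F$ is $\operatorname{conv}(\mathcal Q\cup\{v\})$ for any point $v$ beyond $F$; its face poset does not depend on the choice of $v$. In the construction of $\operatorname{DStell}$, each stellar subdivision is performed on the polytope resulting from the previous ones. *)

(* Defs.v *)
From HB Require Import structures.
From mathcomp Require Import all_boot all_order all_algebra.
From mathcomp Require Import boolp classical_sets.

Set Implicit Arguments.
Unset Strict Implicit.
Unset Printing Implicit Defensive.

Import Order.TTheory GRing.Theory Num.Theory.
Local Open Scope classical_set_scope.
Local Open Scope ring_scope.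

Section Polytopes.
Context {R : realFieldType} {m : nat}.
Implicit Types (A Q F G : set 'rV[R]_m) (x y l v : 'rV[R]_m) (b : R).

Definition dot x y : R := (x *m y^T) 0 0.

Definition aff A : set 'rV[R]_m :=
  [set x | exists k (p : 'I_k -> 'rV[R]_m) (c : 'I_k -> R),
    [/\ forall i, A (p i), \sum_i c i = 1 & x = \sum_i c i *: p i]].

Definition conv A : set 'rV[R]_m :=
  [set x | exists k (p : 'I_k -> 'rV[R]_m) (c : 'I_k -> R),
    [/\ forall i, A (p i), forall i, 0 <= c i,
        \sum_i c i = 1 & x = \sum_i c i *: p i]].

Definition polytope Q := exists s : seq 'rV[R]_m, Q = conv [set` s].

(* [aff A] is [a + U] for a unique linear subspace [U], unless [A] is empty,
   in which case the default value -1 is returned. *)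
Definition aff_dim A : int :=
  xget (-1) [set d : int | exists a (U : {vspace 'rV[R]_m}),
    aff A = [set a + u | u in [set` U]] /\ d = (\dim U)%:Z].

(* The functionals [l = 0], [b = 0] and [l = 0], [b = 1] make [Q] and the
   empty set faces of [Q]. *)
Definition face Q F := exists l b,
  (forall x, Q x -> dot l x <= b) /\ F = Q `&` [set x | dot l x = b].

Definition facet Q G := face Q G /\ aff_dim G = aff_dim Q - 1.

(* When [Q] is full-dimensional and [G] is a facet, the hyperplane [aff G] is
   [{x | dot l x = b}], with the orientation fixed by [dot l x <= b] on [Q]. *)
Definition beyond Q F v := forall G l b,
  facet Q G -> aff G = [set x | dot l x = b] ->
  (forall x, Q x -> dot l x <= b) ->
  (F `<=` G -> b < dot l v) /\ (~ F `<=` G -> dot l v < b).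

Definition stellar_subdivision Q F Q' :=
  [/\ face Q F, F <> set0, F <> Q &
      exists2 v, beyond Q F v & Q' = conv (Q `|` [set v])].

Fixpoint stellar_subdivisions Q (Fs : seq (set 'rV[R]_m)) Q' : Prop :=
  if Fs is F :: Fs' then
    exists2 Q1, stellar_subdivision Q F Q1 & stellar_subdivisions Q1 Fs' Q'
  else Q' = Q.

Definition translate A a : set 'rV[R]_m := [set x - a | x in A].

Definition polar A : set 'rV[R]_m := [set y | forall x, A x -> dot x y <= 1].

End Polytopes.

Section DStell.
Context {R : realFieldType} {n : nat}.

Definition pyr_base (Q : set 'rV[R]_n) : set 'rV[R]_(n + 1) :=
  [set row_mx x 0 | x in Q].

Definition pyr (Q : set 'rV[R]_n) (apex : 'rV[R]_(n + 1)) :=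
  conv (pyr_base Q `|` [set apex]).

(* [D] is one of the polytopes that arise from [Q]: the apex, the order of the
   faces of equal dimension and the new vertices are arbitrary. *)
Definition is_DStell (Q : set 'rV[R]_n) (D : set 'rV[R]_(n + 1)) :=
  exists apex (Fs : seq (set 'rV[R]_(n + 1))),
    [/\ ~ aff (pyr_base Q) apex,
        uniq Fs,
        (forall F, F \in Fs <->
          [/\ face (pyr Q apex) F, F <> pyr Q apex & ~ F `<=` pyr_base Q]),
        sorted (fun F G => aff_dim G <= aff_dim F) Fs &
        stellar_subdivisions (pyr Q apex) Fs D].

End DStell.

Section FacePoset.
Context {R : realFieldType} {m : nat}.
Variable Q : set 'rV[R]_m.

Record face_poset := FacePoset
  { face_set :> set 'rV[R]_m; _ : `[< face Q face_set >] }.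

HB.instance Definition _ := [isSub for face_set].
HB.instance Definition _ := [Choice of face_poset by <:].
HB.instance Definition _ :=
  [SubChoice_isSubPOrder of face_poset by <: with set_display].

Lemma face_set0 : face Q set0.
Proof.
exists 0, 1; split=> [x _|]; first by rewrite /dot mul0mx mxE ler01.
apply/esym/seteqP; split=> // x [_ /=] /eqP.
by rewrite /dot mul0mx mxE eq_sym oner_eq0.
Qed.

Definition face_bot : face_poset := FacePoset (asboolT face_set0).

Lemma face_bot_le (F : face_poset) : (face_bot <= F)%O.
Proof. by rewrite -Order.le_val SetOrder.Exports.subsetEset. Qed.

HB.instance Definition _ :=
  Order.hasBottom.Build set_display face_poset face_bot_le.

End FacePoset.

Fact stell_display : Order.disp_t. Proof. exact: Order.Disp tt tt. Qed.

Section Stell.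
Context {d : Order.disp_t} (P : bPOrderType d).

(* A chain is the strictly increasing sequence of its elements. *)
Definition stell_pair (cy : seq P * P) :=
  [&& ohead cy.1 == Some \bot%O, sorted <%O%O cy.1
    & (last \bot cy.1 <= cy.2)%O].

(* [None] is the added maximum. *)
Definition Stell := option {cy : seq P * P | stell_pair cy}.

HB.instance Definition _ := Choice.on Stell.

Definition stell_le (s t : Stell) :=
  match s, t with
  | _, None => true
  | None, Some _ => false
  | Some cy, Some cy' =>
      all [in (val cy').1] (val cy).1 && ((val cy').2 <= (val cy).2)%O
  end.

Lemma stell_le_refl : reflexive stell_le.
Proof. by case=> //= cy; rewrite lexx andbT; apply/allP. Qed.

Lemma stell_le_anti : antisymmetric stell_le.
Proof.
case=> [[[c y] /= cyP]|] [[[c' y'] /= cyP']|] //=.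
move=> /andP[/andP[/allP cc' y'y] /andP[/allP c'c yy']].
congr Some; apply: val_inj => /=; congr pair; last by apply/le_anti/andP.
case/and3P: cyP => _ /= sc _; case/and3P: cyP' => _ /= sc' _.
apply: lt_sorted_eq => // z; apply/idP/idP; [exact: cc'|exact: c'c].
Qed.

Lemma stell_le_trans : transitive stell_le.
Proof.
case=> [cy|] [cy1|] [cy2|] //= /andP[/allP s1 le1] /andP[/allP s2 le2].
by rewrite (le_trans le2 le1) andbT; apply/allP => z /s1 /s2.
Qed.

HB.instance Definition _ := Order.Le_isPOrder.Build stell_display Stell
  stell_le_refl stell_le_anti stell_le_trans.

End Stell.

Definition poset_iso {d d' : Order.disp_t} (S : porderType d)
    (T : porderType d') :=
  exists2 f : S -> T, bijective f & {mono f : x y / (x <= y)%O}.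

(* Main.v *)
From HB Require Import structures.
Require Import Defs.
From mathcomp Require Import all_boot all_order all_algebra.
From mathcomp Require Import boolp classical_sets reals topology normedtype.
From mathcomp Require Import ring lra zify.

(** A functional valid on a polytope whose supporting hyperplane is not spanned
    by a face can be rotated about that face until it is; hence a
    full-dimensional polytope is the intersection of its facet half-spaces, and
    every face is the intersection of the facets containing it. Consequently
    the proper faces of [conv (Q `|` [set v])], for [v] beyond [F], are the
    faces [H] of [Q] not containing [F], together with the cones over those [H]
    that lie with [F] in a common proper face.

    By induction, after subdividing the pyramid at an upper set [U] of its
    proper faces, the proper faces of the result correspond to the pairs
    [(G, S)] of a proper face [G] outside [U] and a chain [S] in [U] above [G],
    ordered by inclusion in both components. When [U] consists of all proper
    faces not contained in the base, [G] is a face of the polar, that is, some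
    [y] in [F(P)] with the order reversed, and the elements of [S] are the cones
    over the proper faces of the polar, that is, over the nonempty faces of [P];
    so [(G, S)] is an element of the stellahedral transform. *)

Set Implicit Arguments.
Unset Strict Implicit.
Unset Printing Implicit Defensive.
Import Order.TTheory GRing.Theory Num.Theory.
Import numFieldNormedType.Exports.
Local Open Scope classical_set_scope.
Local Open Scope ring_scope.

(** * Linear functionals and convex hulls *)

Section Dot.
Context {R : realFieldType} {m : nat}.
Implicit Types (x y z l : 'rV[R]_m) (c : R).

Lemma dot_sum x y : dot x y = \sum_j x 0 j * y 0 j.
Proof. by rewrite /dot mxE; apply: eq_bigr => j _; rewrite mxE. Qed.

Lemma dotC x y : dot x y = dot y x.
Proof. by rewrite !dot_sum; apply: eq_bigr => j _; rewrite mulrC. Qed.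

Lemma dotDr x y z : dot x (y + z) = dot x y + dot x z.
Proof. by rewrite /dot linearD mulmxDr mxE. Qed.

Lemma dotZr x c y : dot x (c *: y) = c * dot x y.
Proof. by rewrite /dot linearZ -scalemxAr mxE. Qed.

Lemma dotNr x y : dot x (- y) = - dot x y.
Proof. by rewrite -scaleN1r dotZr mulN1r. Qed.

Lemma dot0r x : dot x 0 = 0.
Proof. by rewrite -(scale0r 0) dotZr mul0r. Qed.

Lemma dotDl x y z : dot (x + y) z = dot x z + dot y z.
Proof. by rewrite dotC dotDr !(dotC z). Qed.

Lemma dotZl c x y : dot (c *: x) y = c * dot x y.
Proof. by rewrite dotC dotZr dotC. Qed.

Lemma dotNl x y : dot (- x) y = - dot x y.
Proof. by rewrite dotC dotNr dotC. Qed.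

Lemma dot0l x : dot 0 x = 0.
Proof. by rewrite dotC dot0r. Qed.

Definition dotE := (dotDr, dotDl, dotNr, dotNl, dotZr, dotZl, dot0r, dot0l).

Lemma dot_sumr (I : Type) (r : seq I) (f : I -> 'rV[R]_m) x :
  dot x (\sum_(i <- r) f i) = \sum_(i <- r) dot x (f i).
Proof. exact: (big_morph (dot x) (dotDr x) (dot0r x)). Qed.

Lemma dot_gt0 x : x != 0 -> 0 < dot x x.
Proof.
move=> /rV0Pn[j xj]; rewrite dot_sum lt_def sumr_ge0 ?andbT; last first.
  by move=> i _; rewrite -expr2 sqr_ge0.
rewrite psumr_eq0 => [|i _]; last by rewrite -expr2 sqr_ge0.
by apply/negP => /allP/(_ j (mem_index_enum j)) /=; rewrite mulf_eq0 orbb (negPf xj).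
Qed.

Lemma dot_eq0 l : (forall x, dot l x = 0) -> l = 0.
Proof.
move=> l0; apply/eqP/negPn/negP => /dot_gt0; by rewrite l0 ltxx.
Qed.

Lemma linear_dot (f : {linear 'rV[R]_m -> R^o}) : exists l, forall x, f x = dot l x.
Proof.
exists (\row_j f (delta_mx 0 j)) => x.
rewrite dot_sum {1}(row_sum_delta x) linear_sum; apply: eq_bigr => j _.
by rewrite linearZ mxE mulrC.
Qed.

(** Any [x] minus its projection along [l] lies in the kernel of [l], hence in that of [l']; so [l']
    and the multiple of [l] agree on every [x]. *)
Lemma dot_scalar_mult l l' : l != 0 -> (forall x, dot l x = 0 -> dot l' x = 0) ->
  exists c, l' = c *: l.
Proof.
move=> /dot_gt0 l0 h; exists (dot l' l / dot l l).
apply/eqP; rewrite -subr_eq0; apply/eqP; apply: dot_eq0 => x.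
have /h : dot l (x - (dot l x / dot l l) *: l) = 0 by rewrite !dotE; field; lra.
rewrite !dotE => e.
have -> : dot l' x = dot l x / dot l l * dot l' l by lra.
by ring.
Qed.

End Dot.

Section Conv.
Context {R : realFieldType} {m : nat}.
Implicit Types (A B Q F G : set 'rV[R]_m) (x y l v : 'rV[R]_m) (b c t : R)
  (s : seq 'rV[R]_m).

Lemma sub_conv A : A `<=` conv A.
Proof.
move=> x Ax; exists 1%N, (fun=> x), (fun=> 1).
by split=> //; rewrite ?big_ord1 ?scale1r // => i; rewrite ler01.
Qed.

Lemma conv_mono A B : A `<=` B -> conv A `<=` conv B.
Proof. by move=> AB x [k [p [c [Ap c0 c1 ->]]]]; exists k, p, c; split=> // i; apply: AB. Qed.

Definition convex A :=
  forall x y t, A x -> A y -> 0 <= t -> t <= 1 -> A (x + t *: (y - x)).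

Lemma convex_conv A : convex (conv A).
Proof.
move=> x y t [k [p [c [Ap c0 c1 ->]]]] [k' [p' [c' [Ap' c0' c1' ->]]]] t0 t1.
exists (k + k')%N,
  (fun i => match split i with inl j => p j | inr j => p' j end),
  (fun i => match split i with inl j => (1 - t) * c j | inr j => t * c' j end).
split=> [i|i||].
- by case: (split i) => j.
- by case: (split i) => j; rewrite mulr_ge0 // subr_ge0.
- rewrite big_split_ord /=.
  under eq_bigr do rewrite (unsplitK (inl _)).
  under [X in _ + X]eq_bigr do rewrite (unsplitK (inr _)).
  by rewrite -!mulr_sumr c1 c1'; ring.
- rewrite big_split_ord /=.
  under [X in _ = X + _]eq_bigr do rewrite (unsplitK (inl _)) -scalerA.
  under [X in _ = _ + X]eq_bigr do rewrite (unsplitK (inr _)) -scalerA.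
  by rewrite -!scaler_sumr scalerBl scale1r scalerBr addrA addrAC.
Qed.

(** Induction on the number of points: split off the first one and rescale the other weights by
    [1 - c ord0]. *)
Lemma conv_sub_convex A B : convex B -> A `<=` B -> conv A `<=` B.
Proof.
move=> cB AB x [k [p [c [Ap c0 c1 ->]]]].
have {A Ap AB} Bp i : B (p i) by apply: AB.
elim: k p c c0 c1 Bp => [|k IH] p c c0 c1 Bp.
  by move: c1; rewrite big_ord0 => /eqP; rewrite eq_sym oner_eq0.
move: c1; rewrite !big_ord_recl => c1.
(* If the first weight is 1, rescaling would divide by zero, but then all other weights vanish. *)
have [e1|n1] := eqVneq (c ord0) 1.
  have z : \sum_(i < k) c (lift ord0 i) = 0 by move: c1; rewrite e1; lra.
  rewrite e1 scale1r big1 ?addr0 // => i _.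
  by rewrite (psumr_eq0P _ z) ?scale0r // => j _.
have d0 : 0 < 1 - c ord0.
  rewrite lt_def subr_eq0 eq_sym n1 subr_ge0 -c1 lerDl sumr_ge0 //.
have -> : c ord0 *: p ord0 + \sum_(i < k) c (lift ord0 i) *: p (lift ord0 i) =
   p ord0 + (1 - c ord0) *:
     (\sum_(i < k) (c (lift ord0 i) / (1 - c ord0)) *: p (lift ord0 i) - p ord0).
  rewrite scalerBr scaler_sumr; under [X in _ = _ + (X - _)]eq_bigr do
    rewrite scalerA mulrC mulfVK ?(gt_eqF d0) //.
  by rewrite [(1 - _) *: p ord0]scalerBl scale1r opprB addrCA subrKC addrC.
apply: cB => //; [|exact: ltW|by rewrite gerBl].
apply: IH => [i||i] //; first by rewrite divr_ge0 // ltW.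
by rewrite -mulr_suml -[X in X / _](addKr (c ord0)) c1 addrC divff // gt_eqF.
Qed.

Lemma conv_convex A : convex A -> conv A = A.
Proof.
by move=> cA; apply/seteqP; split; [apply: conv_sub_convex|apply: sub_conv].
Qed.

Lemma convUl A B : conv (conv A `|` B) = conv (A `|` B).
Proof.
apply/seteqP; split.
  apply: conv_sub_convex (@convex_conv _) _ => x [|Bx].
    by apply: conv_mono => y; left.
  by apply: sub_conv; right.
by apply: conv_mono => x [Ax|Bx]; [left; apply: sub_conv|right].
Qed.

Definition valid Q l b := forall x, Q x -> dot l x <= b.

Lemma convex_valid l b : convex [set x | dot l x <= b].
Proof.
move=> x y t /= lx ly t0 t1; rewrite !dotE.
have : 0 <= (1 - t) * (b - dot l x) + t * (b - dot l y).
  by rewrite addr_ge0 // mulr_ge0 ?subr_ge0.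
lra.
Qed.

Lemma valid_conv A l b : valid A l b -> valid (conv A) l b.
Proof. by move=> vA; apply: (conv_sub_convex (@convex_valid l b)). Qed.

Lemma eq_dot_conv A l b :
  (forall x, A x -> dot l x = b) -> forall x, conv A x -> dot l x = b.
Proof.
move=> h x Ax; apply/le_anti/andP; split.
  by apply: (valid_conv _ Ax) => y /h ->.
by rewrite -lerN2 -dotNl; apply: (valid_conv _ Ax) => y /h; rewrite dotNl => ->.
Qed.

(** The slacks [b - dot l (p i)] are nonnegative and their weighted sum is zero, so every point of
    nonzero weight lies on the hyperplane. *)
Lemma conv_face A l b : valid A l b ->
  conv A `&` [set x | dot l x = b] = conv (A `&` [set x | dot l x = b]).
Proof.
move=> vA; apply/seteqP; split; last first.
  move=> x cx; split; first by apply: conv_mono cx => y [].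
  by apply: eq_dot_conv cx => y [].
move=> _ [[k [p [c [Ap c0 c1 ->]]]] /= e].
have z i : c i * (b - dot l (p i)) = 0.
  have : \sum_i c i * (b - dot l (p i)) = 0.
    under eq_bigr do rewrite mulrBr.
    rewrite big_split /= -mulr_suml c1 mul1r sumrN -[X in X - _]e dot_sumr.
    by under eq_bigr do rewrite dotZr; rewrite subrr.
  by move/psumr_eq0P => -> // j _; rewrite mulr_ge0 // subr_ge0 vA.
have [i0 ci0] : exists i, c i != 0.
  apply: contrapT => /forallNP h; move: c1.
  rewrite big1 => [/eqP|i _]; first by rewrite eq_sym oner_eq0.
  by apply/eqP/negPn/negP/h.
have onp i : c i != 0 -> dot l (p i) = b.
  by move=> ci; have /eqP := z i; rewrite mulf_eq0 (negPf ci) /= subr_eq0 => /eqP.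
(* Points of weight zero may lie off the hyperplane; they are replaced by [p i0], which lies on
   it. *)
exists k, (fun i => if c i == 0 then p i0 else p i), c; split=> //.
  by move=> i; case: ifPn => ci; split=> //=; exact: onp.
by apply: eq_bigr => i _; case: eqP => // ->; rewrite !scale0r.
Qed.

End Conv.

(** * Separation of a point from a polytope *)

Lemma dot_row_mx {R : realFieldType} {m n : nat} (a c : 'rV[R]_m) (b d : 'rV[R]_n) :
  dot (row_mx a b) (row_mx c d) = dot a c + dot b d.
Proof. by rewrite /dot tr_row_mx mul_row_col mxE. Qed.

Lemma dot_scalar {R : realFieldType} (a : 'rV[R]_1) (c : R) :
  dot a (const_mx c) = a 0 0 * c.
Proof. by rewrite dot_sum big_ord1 mxE. Qed.

Section FiniteChoice.

Lemma ex_argmin {T : eqType} {R : realFieldType} (s : seq T) (P : T -> Prop) (f : T -> R) :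
  (exists2 y, y \in s & P y) ->
  exists y, [/\ y \in s, P y & forall z, z \in s -> P z -> f y <= f z].
Proof.
elim: s => [|a s IH] [y //]; rewrite inE => ys Py.
have [/IH[z [zs Pz zmin]]|nP] := pselect (exists2 y, y \in s & P y).
  have [|za] := lerP (f z) (f a).
    exists z; split=> [||w]; rewrite ?inE ?zs ?orbT // => /orP[/eqP -> //|]; exact: zmin.
  have [Pa|nPa] := pselect (P a).
    exists a; split=> [||w]; rewrite ?inE ?eqxx // => /orP[/eqP -> //|ws Pw].
    exact/(le_trans (ltW za))/zmin.
  by exists z; split=> [||w]; rewrite ?inE ?zs ?orbT // => /orP[/eqP ->|/zmin].
have ya : y = a by move: ys => /orP[/eqP //|ys]; case: nP; exists y.
exists a; split=> [||w]; rewrite ?inE ?eqxx -?ya // => /orP[/eqP -> //|ws Pw].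
by case: nP; exists w.
Qed.

(** The minimum of finitely many thresholds works; [1 + |g a|] in the denominator keeps each of them
    defined and positive. *)
Lemma ex_small {T : eqType} {R : realFieldType} (s : seq T) (f g : T -> R) :
  (forall y, y \in s -> 0 < f y) ->
  exists2 e, 0 < e & forall y, y \in s -> e * g y < f y.
Proof.
elim: s => [|a s IH] f0; first by exists 1.
have [|e e0 he] := IH; first by move=> y ys; apply: f0; rewrite inE ys orbT.
have fa : 0 < f a by apply: f0; rewrite inE eqxx.
have d0 : 0 < 1 + `|g a| by rewrite ltr_wpDr.
exists (Num.min e (f a / (1 + `|g a|))); first by rewrite lt_min e0 divr_gt0.
have m0 : 0 < Num.min e (f a / (1 + `|g a|)) by rewrite lt_min e0 divr_gt0.
move=> y; rewrite inE => /orP[/eqP ->|ys].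
  have [ga|ga] := lerP (g a) 0; first by rewrite (le_lt_trans _ fa) // pmulr_rle0.
  apply: (@le_lt_trans _ _ (f a / (1 + `|g a|) * g a)).
    by rewrite ler_pM2r // ge_min lexx orbT.
  by rewrite mulrAC ltr_pdivrMr // ltr_pM2l // gtr0_norm // ltrDr.
have [gy|gy] := lerP (g y) 0.
  rewrite (@le_lt_trans _ _ 0) // ?pmulr_rle0 // f0 // inE ys orbT //.
by rewrite (le_lt_trans _ (he y ys)) // ler_pM2r // ge_min lexx.
Qed.

(** One witness is chosen for each attained key. This yields finiteness of facets and of faces, both
    controlled by the generators they contain. *)
Lemma finite_reps {A : eqType} {K : finType} (key : A -> K) (P : A -> Prop) :
  exists L : seq A, (forall a, a \in L -> P a) /\
    forall a, P a -> exists2 a', a' \in L & key a' = key a.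
Proof.
pose Pk k := exists a, P a /\ key a = k.
pose g k := if pselect (Pk k) is left h then Some (sval (cid h)) else None.
exists (pmap g (enum K)); split=> [a|a Pa].
  rewrite mem_pmap => /mapP[k _]; rewrite /g.
  by case: pselect => // h [->]; case: (svalP (cid h)).
have h : Pk (key a) by exists a.
exists (sval (cid h)); last by case: (svalP (cid h)).
rewrite mem_pmap; apply/mapP; exists (key a); first by rewrite mem_enum.
by rewrite /g; case: pselect => // h'; rewrite (Prop_irrelevance h h').
Qed.

End FiniteChoice.

Section Separation.
Context {R : realFieldType}.

(** The convex cone generated by [s], peeled off one generator at a time to match the induction in
    Farkas' lemma. *)
Fixpoint cone {m} (s : seq 'rV[R]_m) (x : 'rV[R]_m) : Prop :=
  if s is a :: s' then exists2 t, 0 <= t & cone s' (x - t *: a) else x = 0.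

Lemma cone_le {m} (s : seq 'rV[R]_m) l x :
  (forall y, y \in s -> dot l y <= 0) -> cone s x -> dot l x <= 0.
Proof.
elim: s x => [|a s IH] x h /=; first by move=> ->; rewrite dot0r.
move=> [t t0 /IH]; rewrite dotDr dotNr dotZr.
have la : dot l a <= 0 by apply: h; rewrite inE eqxx.
have := mulr_ge0_le0 t0 la.
have h' y : y \in s -> dot l y <= 0 by move=> ys; apply: h; rewrite inE ys orbT.
by move=> + /(_ h'); lra.
Qed.

Lemma cone_map {m} (f : {linear 'rV[R]_m -> 'rV[R]_m}) s z :
  cone (map f s) z -> exists2 w, cone s w & z = f w.
Proof.
elim: s z => [|a s IH] z /=; first by move=> ->; exists 0; rewrite ?linear0.
move=> [t t0 /IH[w sw e]]; exists (w + t *: a); first by exists t; rewrite ?addrK.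
by rewrite linearD linearZ /= -e subrK.
Qed.

(* When the functional given by the induction hypothesis is positive on the
   new generator [a], project along [a] onto its kernel. *)
Lemma farkas {m} (s : seq 'rV[R]_m) x : ~ cone s x ->
  exists l, (forall y, y \in s -> dot l y <= 0) /\ 0 < dot l x.
Proof.
move: {2}(size s) (erefl (size s)) x => k; elim: k s => [|k IH] [|a s] //=.
  by move=> _ x x0; exists x; split=> //; apply: dot_gt0; apply/eqP.
case=> sk x nx; have [|l [ls lx]] := IH s sk x.
  by move=> sx; apply: nx; exists 0; rewrite ?scale0r ?subr0.
have [la|la] := lerP (dot l a) 0.
  by exists l; split=> // y; rewrite inE => /orP[/eqP ->|/ls].
pose p (y : 'rV[R]_m) := y - (dot l y / dot l a) *: a.
have p_lin : linear p.
  move=> c u w; rewrite /p !dotE scalerBr scalerA mulrDl scalerDl opprD mulrA.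
  by rewrite !addrA; congr (_ + _); rewrite addrAC.
pose pL : {linear 'rV[R]_m -> 'rV[R]_m} :=
  HB.pack p (GRing.isLinear.Build _ _ _ _ p p_lin).
have [||l2 [l2s l2x]] := IH (map pL s) _ (pL x); first by rewrite size_map.
  move=> /cone_map[w sw e]; apply: nx.
  exists ((dot l x - dot l w) / dot l a).
    by rewrite divr_ge0 ?(ltW la) // subr_ge0 (le_trans (cone_le ls sw)) // ltW.
  rewrite mulrBl scalerBl opprB addrA addrAC.
  by move: e => /= ; rewrite {1}/p => ->; rewrite subrK.
exists (l2 - (dot l2 a / dot l a) *: l).
have e y : dot (l2 - (dot l2 a / dot l a) *: l) y = dot l2 (p y).
  by rewrite /p !dotE; ring.
split=> [y|]; rewrite e //; rewrite inE => /orP[/eqP ->|ys].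
  by rewrite /p divff ?gt_eqF // scale1r subrr dot0r.
by apply: l2s; apply/mapP; exists y.
Qed.

(** Over generators lifted to height 1, the last coordinate of a conic combination records its total
    weight. *)
Lemma cone_conv {m} (s : seq 'rV[R]_m) z :
  cone [seq row_mx y (const_mx 1 : 'rV_1) | y <- s] z ->
  exists k (p : 'I_k -> 'rV[R]_m) (c : 'I_k -> R),
    [/\ forall i, p i \in s, forall i, 0 <= c i &
      z = row_mx (\sum_i c i *: p i) (const_mx (\sum_i c i) : 'rV_1)].
Proof.
elim: s z => [|a s IH] z /=.
  move=> ->; exists 0%N, (fun=> 0), (fun=> 0); split=> [[]|[]|] //.
  by rewrite !big_ord0 [const_mx 0](_ : _ = 0) ?row_mx0 //; apply/matrixP => i j; rewrite !mxE.
move=> [t t0 /IH[k [p [c [ps c0 e]]]]].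
exists k.+1, (fun i => if unlift ord0 i is Some j then p j else a),
  (fun i => if unlift ord0 i is Some j then c j else t); split=> [i|i|].
- by case: (unlift _ i) => [j|]; rewrite inE ?eqxx // ps orbT.
- by case: (unlift _ i).
rewrite !big_ord_recl unlift_none.
under eq_bigr do rewrite liftK.
under [X in const_mx (_ + X)]eq_bigr do rewrite liftK.
move: e => /eqP; rewrite subr_eq => /eqP ->.
rewrite scale_row_mx add_row_mx addrC; congr row_mx; apply/matrixP => i j.
by rewrite !mxE mulr1 addrC.
Qed.

(** Homogenisation: lift everything to height 1 and apply Farkas' lemma to the cone over the lifted
    generators. The last coordinate of the functional becomes the constant term. *)
Lemma separation {m} (s : seq 'rV[R]_m) x : ~ conv [set` s] x ->
  exists l b, valid (conv [set` s]) l b /\ b < dot l x.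
Proof.
pose h y : 'rV[R]_(m + 1) := row_mx y (const_mx 1).
move=> nx; have [|L [Ls Lx]] := @farkas _ [seq h y | y <- s] (h x).
  move=> /cone_conv[k [p [c [ps c0 /eq_row_mx[e1 /matrixP/(_ 0 0)]]]]].
  by rewrite !mxE => e2; apply: nx; exists k, p, c.
have e y : dot L (h y) = dot (lsubmx L) y + rsubmx L 0 0.
  by rewrite -{1}(hsubmxK L) dot_row_mx dot_scalar mulr1.
exists (lsubmx L), (- rsubmx L 0 0); split.
  apply: valid_conv => y /= ys; have := Ls (h y); rewrite e.
  by move=> /(_ (map_f _ ys)); lra.
by move: Lx; rewrite e; lra.
Qed.

End Separation.

(** * Faces and relative interior points of polytopes *)

Section Polytope.
Context {R : realFieldType} {m : nat}.
Implicit Types (A B Q F G : set 'rV[R]_m) (x y l v : 'rV[R]_m) (b c t : R)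
  (s : seq 'rV[R]_m).

Lemma polytope_separation Q x : polytope Q -> ~ Q x ->
  exists l b, valid Q l b /\ b < dot l x.
Proof. by move=> [s ->]; apply: separation. Qed.

Lemma convex_polytope Q : polytope Q -> convex Q.
Proof. by move=> [s ->]; apply: convex_conv. Qed.

Lemma conv_polytope Q : polytope Q -> conv Q = Q.
Proof. by move=> /convex_polytope/conv_convex. Qed.

Lemma conv_seq_face s l b : valid (conv [set` s]) l b ->
  conv [set` s] `&` [set x | dot l x = b] = conv [set` [seq y <- s | dot l y == b]].
Proof.
move=> v; rewrite conv_face => [|x sx]; last exact/v/sub_conv.
congr conv; apply/seteqP; split=> x /=; rewrite mem_filter.
  by move=> [-> ->]; rewrite eqxx.
by move=> /andP[/eqP -> ->].
Qed.

Lemma face_sub Q F : face Q F -> F `<=` Q.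
Proof. by move=> [l [b [_ ->]]] x []. Qed.

Lemma polytope_face Q F : polytope Q -> face Q F -> polytope F.
Proof.
move=> [s ->] [l [b [v ->]]]; rewrite conv_seq_face //.
by exists [seq y <- s | dot l y == b].
Qed.

Lemma polytopeU1 Q v : polytope Q -> polytope (conv (Q `|` [set v])).
Proof.
move=> [s ->]; exists (v :: s); rewrite convUl; congr conv.
apply/seteqP; split=> x /=; rewrite inE.
  by move=> [->|->]; rewrite ?eqxx ?orbT.
by move=> /orP[/eqP|]; [right|left].
Qed.

Lemma conv0 : conv (@set0 'rV[R]_m) = set0.
Proof.
apply/seteqP; split=> // x [k [p [c [p0 _]]]].
case: k p c p0 => [|k] p c p0; last by case: (p0 ord0).
by rewrite big_ord0 => /eqP; rewrite eq_sym oner_eq0.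
Qed.

Lemma set_nil_rV : [set` [::] : seq 'rV[R]_m] = set0.
Proof. by apply/seteqP; split. Qed.

(** The barycentre of the generators works: a functional that is maximal there has total slack zero,
    so it is maximal at each generator. *)
Lemma relint_point F : polytope F -> F !=set0 ->
  exists2 p, F p & forall l b, valid F l b -> dot l p = b ->
    forall x, F x -> dot l x = b.
Proof.
move=> [s ->] [x0 sx0].
have s0 : (0 < size s)%N.
  by case: s sx0 => //; rewrite set_nil_rV conv0.
have n0 : (size s)%:R != 0 :> R by rewrite pnatr_eq0 -lt0n.
exists (\sum_(i < size s) (size s)%:R^-1 *: s`_i).
  exists (size s), (fun i => s`_i), (fun=> (size s)%:R^-1); split=> // [i|i|].
  - by apply: mem_nth.
  - by rewrite invr_ge0 ler0n.
  - by rewrite sumr_const card_ord -[X in X *+ _]mul1r -mulrnAr -mulr_natl mul1r mulfV.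
move=> l b v e; apply: eq_dot_conv => y ys.
have z : \sum_(i < size s) (b - dot l s`_i) = 0.
  move: e; rewrite -scaler_sumr dotZr dot_sumr => <-.
  by rewrite sumrB sumr_const card_ord -[_^-1 * _ *+ _]mulr_natl mulrA mulfV // mul1r subrr.
have h (i : 'I_(size s)) : 0 <= b - dot l s`_i.
  by rewrite subr_ge0; apply: v; apply: sub_conv; apply: mem_nth.
have iy : (index y s < size s)%N by rewrite index_mem.
have := psumr_eq0P (fun i _ => h i) z (i := Ordinal iy) isT.
by rewrite /= nth_index // => /eqP; rewrite subr_eq0 => /eqP.
Qed.

End Polytope.

(** * Facet inequalities *)

Lemma ltn_count {T : eqType} (a1 a2 : pred T) (s : seq T) y :
  {in s, subpred a1 a2} -> y \in s -> ~~ a1 y -> a2 y -> (count a1 s < count a2 s)%N.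
Proof.
move=> sub + na1 a2y; elim: s sub => // z s IH sub.
have sub' : {in s, subpred a1 a2} by move=> w ws; apply: sub; rewrite inE ws orbT.
rewrite inE /= => /orP[/eqP <-|/(IH sub') lt].
  rewrite (negPf na1) a2y add0n add1n ltnS -!size_filter.
  by rewrite !size_filter -[count a1 s](@eq_in_count _ (predI a1 a2)) ?sub_count //
    => w /= => [/andP[]|ws] //; case: (boolP (a1 w)) => //= /(sub' _ ws) ->.
rewrite -addnS leq_add //; case: (boolP (a1 z)) => // /sub -> //; exact: mem_head.
Qed.

Section Facets.
Context {R : realFieldType} {m : nat}.
Implicit Types (A B Q F G : set 'rV[R]_m) (x y z p l u v : 'rV[R]_m) (b c t : R)
  (s : seq 'rV[R]_m).

(** Full-dimensionality in dual form: only the zero functional is constant on [Q]. *)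
Definition full Q := forall l b, (forall x, Q x -> dot l x = b) -> l = 0.

(** A facet described without dimensions. The two middle clauses exclude the faces [Q] and [set0];
    the last one says that the face spans its hyperplane. *)
Definition facet_ineq Q l b :=
  [/\ valid Q l b, exists2 c, Q c & dot l c < b, exists2 g, Q g & dot l g = b &
    forall l' b', (forall x, Q x -> dot l x = b -> dot l' x = b') ->
      exists c, l' = c *: l].

Lemma full_lt Q l b : full Q -> valid Q l b -> l != 0 ->
  exists2 c, Q c & dot l c < b.
Proof.
move=> fQ v /eqP l0; apply: contrapT => h; apply/l0/(fQ _ b) => x Qx.
apply/le_anti; rewrite v //= leNgt; apply/negP => lx; by apply: h; exists x.
Qed.

(* As long as the face cut out by [l] does not determine [l] up to scaling,
   rotate the hyperplane about the face and the trace of [x]. *)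
Lemma facet_violated Q l b g x : polytope Q -> full Q -> valid Q l b ->
  Q g -> dot l g = b -> b < dot l x ->
  exists l' b', [/\ facet_ineq Q l' b',
    forall y, Q y -> dot l y = b -> dot l' y = b' & b' < dot l' x].
Proof.
move=> [s ->] fQ; move: l b; set Q' := conv _ => l b.
move: {2}(count (fun y => dot l y < b) s).+1 (ltnSn (count (fun y => dot l y < b) s)) => k.
elim: k l b => // k IH l b; rewrite ltnS => ck v Qg lg lx.
have l0 : l != 0.
  by apply/eqP => l0; move: lx; rewrite -lg l0 !dot0l ltxx.
have [ext|] := pselect (forall l' b', (forall x, Q' x -> dot l x = b -> dot l' x = b') ->
      exists c, l' = c *: l).
  exists l, b; split=> //; split=> //; last by exists g.
  exact: full_lt.
move=> /existsNP[u /existsNP[d /not_implyP[ud nu]]].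
suff key u' d' : (forall y, Q' y -> dot l y = b -> dot u' y = d') -> dot u' x = d' ->
    (exists2 y, y \in s & d' < dot u' y) ->
    exists l' b', [/\ facet_ineq Q' l' b',
    forall y, Q' y -> dot l y = b -> dot l' y = b' & b' < dot l' x].
  (* Subtracting [r *: l] makes the functional take at [x] the value it has on the face, so that
     rotating with it leaves the violation at [x] unchanged. One of the two signs then exceeds that
     value at some generator. *)
  pose r := (dot u x - d) / (dot l x - b).
  pose u2 := u - r *: l; pose d2 := d - r * b.
  have u2d y : Q' y -> dot l y = b -> dot u2 y = d2.
    by move=> Qy e; rewrite /u2 !dotE (ud _ Qy e) e /d2.
  have u2x : dot u2 x = d2.
    have n0 : dot l x - b != 0 by rewrite gt_eqF // subr_gt0.
    by rewrite /u2 /d2 !dotE /r; field.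
  have [y ys ne] : exists2 y, y \in s & dot u2 y != d2.
    apply: contrapT => h; apply: nu; exists r; apply/eqP; rewrite -subr_eq0; apply/eqP.
    apply: (fQ _ d2); apply: eq_dot_conv => y ys; apply/eqP/negPn/negP => e.
    by apply: h; exists y.
  have [lt|lt|/eqP] := ltgtP (dot u2 y) d2; last by rewrite (negPf ne).
    apply: (key (- u2) (- d2)) => [z Qz lz||]; rewrite ?dotNl ?u2x ?u2d //.
    by exists y; rewrite // dotNl ltrN2.
  by apply: (key u2 d2) => //; exists y.
move=> {}ud ux /(ex_argmin (fun y => (b - dot l y) / (dot u' y - d')))[y0 [y0s uy0 ymin]].
(* Ratio test: [t] is the largest rotation that keeps the inequality valid. It makes the generator
   [y0] tight, so fewer generators remain strict. *)
set t := _ / _ in ymin.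
have sQ y : y \in s -> Q' y by move=> ys; apply: sub_conv.
have vs y : y \in s -> dot l y <= b by move=> /sQ/v.
have ly0 : dot l y0 < b.
  rewrite lt_neqAle vs // andbT; apply/eqP => e.
  by move: uy0; rewrite (ud _ (sQ _ y0s) e) ltxx.
have t0 : 0 < t by rewrite divr_gt0 // subr_gt0.
have l'd y : dot (l + t *: u') y = dot l y + t * dot u' y by rewrite !dotE.
have [|||||l' [b' [fi sub xb']]] := IH (l + t *: u') (b + t * d').
- apply: leq_trans ck; apply: (ltn_count (y := y0)) => // [y ys|] /=.
  + rewrite l'd; have [ly|ly] := ltP (dot l y) b => // h.
    have e : dot l y = b by apply/le_anti; rewrite ly vs.
    by move: h; rewrite e (ud _ (sQ _ ys) e) ltxx.
  + rewrite l'd -leNgt; have n0 : dot u' y0 - d' != 0 by rewrite gt_eqF // subr_gt0.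
    suff -> : dot l y0 + t * dot u' y0 = b + t * d' by [].
    by rewrite /t; field.
- apply: valid_conv => y /= ys; rewrite l'd.
  have [uy|uy] := lerP (dot u' y) d'; first by rewrite lerD ?vs // ler_pM2l.
  have := ymin y ys uy; rewrite ler_pdivlMr ?subr_gt0 //; lra.
- exact: Qg.
- by rewrite l'd lg (ud g).
- by rewrite l'd ux ltrD2r.
exists l', b'; split=> // y Qy ly; apply: sub => //.
by rewrite l'd ly (ud y).
Qed.


Lemma polytope_touch Q l : polytope Q -> Q !=set0 ->
  exists2 g, Q g & valid Q l (dot l g).
Proof.
move=> [s ->] [x sx].
have [|g [gs _ gmax]] := @ex_argmin _ _ s xpredT (fun y => - dot l y).
  apply: contrapT => h; move: sx.
  suff -> : [set` s] = set0 by rewrite conv0.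
  by apply/seteqP; split=> // y ys; apply: h; exists y.
exists g; first exact: sub_conv.
by apply: valid_conv => y /= ys; have := gmax y ys isT; lra.
Qed.

(** A separating hyperplane is pushed until it touches [Q], then rotated into a facet inequality
    that [x] still violates. *)
Lemma facet_hrep Q x : polytope Q -> full Q -> Q !=set0 ->
  (forall l b, facet_ineq Q l b -> dot l x <= b) -> Q x.
Proof.
move=> pQ fQ Q0 h; apply: contrapT => /(polytope_separation pQ)[l [b [v lx]]].
have [g Qg vg] := polytope_touch l pQ Q0.
have [|l' [b' [/h]]] := facet_violated (x := x) pQ fQ vg Qg erefl.
  exact/(le_lt_trans (v _ Qg)).
by move=> + _; rewrite leNgt => /negP.
Qed.

(** This expresses a face as the intersection of the facets containing it: each point outside the
    face is missed by one of these facets. *)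
Lemma face_facet_avoid Q G z : (0 < m)%N -> polytope Q -> full Q ->
  face Q G -> Q z -> ~ G z ->
  exists l b, [/\ facet_ineq Q l b, forall y, G y -> dot l y = b & dot l z < b].
Proof.
move=> m0 pQ fQ; have step l b g : valid Q l b -> Q g -> dot l g = b ->
    Q z -> dot l z < b ->
    exists l' b', [/\ facet_ineq Q l' b',
      forall y, Q y -> dot l y = b -> dot l' y = b' & dot l' z < b'].
  move=> v Qg lg Qz lz.
  (* The reflection of [z] in [g] violates the inequality; after the rotation [g] is tight and the
     reflection still violated, so [z] is strict. *)
  have [|l' [b' [fi sub]]] := facet_violated (x := g + (g - z)) pQ fQ v Qg lg.
    by rewrite !dotE; lra.
  rewrite !dotE (sub _ Qg lg) => h; exists l', b'; split=> //; lra.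
move=> [l [b [v ->]]] Qz nGz.
have lz : dot l z < b.
  by rewrite lt_neqAle v // andbT; apply/eqP => e; apply: nGz.
have [[g [Qg lg]]|G0] := pselect (exists g, Q g /\ dot l g = b).
  have [l' [b' [fi sub lz']]] := step _ _ _ v Qg lg Qz lz.
  by exists l', b'; split=> // y [Qy ly]; apply: sub.
(* For the empty face any facet missing [z] will do. A coordinate, which exists as [0 < m], is not
   constant on [Q], so [z] fails to attain its maximum or its minimum. *)
pose e : 'rV[R]_m := delta_mx 0 (Ordinal m0).
have e0 : e != 0.
  by apply/eqP => /matrixP/(_ 0 (Ordinal m0))/eqP; rewrite !mxE !eqxx oner_eq0.
have Q0 : Q !=set0 by exists z.
have avoid l' g : valid Q l' (dot l' g) -> Q g -> dot l' z < dot l' g ->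
  exists l0 b0, [/\ facet_ineq Q l0 b0,
    forall y, Q y /\ dot l y = b -> dot l0 y = b0 & dot l0 z < b0].
  move=> v' Qg lg; have [l0 [b0 [fi _ lz0]]] := step _ _ _ v' Qg erefl Qz lg.
  by exists l0, b0; split=> // y ?; case: G0; exists y.
have [g Qg vg] := polytope_touch e pQ Q0.
have [g' Qg' vg'] := polytope_touch (- e) pQ Q0.
have := vg _ Qz; rewrite le_eqVlt => /orP[/eqP ez|/avoid]; last exact.
have := vg' _ Qz; rewrite le_eqVlt => /orP[/eqP ez'|/avoid]; last exact.
move: ez'; rewrite !dotNl => /oppr_inj ez'.
case/eqP: e0; apply: (fQ _ (dot e z)) => y Qy; apply/le_anti.
by rewrite {1}ez vg //= ez'; have := vg' _ Qy; rewrite !dotNl lerN2.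
Qed.

Lemma face_in_facet Q G : (0 < m)%N -> polytope Q -> full Q ->
  face Q G -> G <> Q ->
  exists l b, facet_ineq Q l b /\ forall y, G y -> dot l y = b.
Proof.
move=> m0 pQ fQ fG GQ.
have [w Qw Gw] : exists2 w, Q w & ~ G w.
  apply: contrapT => h; apply: GQ; apply/seteqP; split=> [|y Qy]; first exact: face_sub.
  by apply: contrapT => Gy; apply: h; exists y.
by have [l [b [fi Gl _]]] := face_facet_avoid m0 pQ fQ fG Qw Gw; exists l, b.
Qed.

Lemma facet_ineq_scale Q l b l' b' : facet_ineq Q l b -> facet_ineq Q l' b' ->
  (forall x, Q x -> dot l x = b -> dot l' x = b') ->
  exists2 c, 0 < c & l' = c *: l /\ b' = c * b.
Proof.
move=> [v [x Qx lx] [g Qg lg] ext] [v' [x' _ lx'] _ _] sub.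
have [c e] := ext l' b' sub; have eb : b' = c * b by rewrite -(sub g Qg lg) e dotZl lg.
have c0 : c != 0.
  by apply/eqP => c0; move: lx'; rewrite e eb c0 scale0r dot0l mul0r ltxx.
exists c => //; rewrite lt_neqAle eq_sym c0 /= leNgt; apply/negP => c_lt0.
by have := v' x Qx; rewrite e eb dotZl ler_nM2l // leNgt lx.
Qed.

(** Up to a positive factor, a facet inequality is determined by the generators at which it is
    tight. *)
Lemma facet_ineq_finite Q : polytope Q ->
  exists L : seq ('rV[R]_m * R), (forall q, q \in L -> facet_ineq Q q.1 q.2) /\
    forall l b, facet_ineq Q l b -> exists2 q, q \in L &
      exists2 c, 0 < c & l = c *: q.1 /\ b = c * q.2.
Proof.
move=> [s Qs].
pose key (q : 'rV[R]_m * R) := [ffun i : 'I_(size s) => dot q.1 s`_i == q.2].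
have [L [Lfi LP]] := finite_reps key (fun q => facet_ineq Q q.1 q.2).
exists L; split=> // l b fi; have [q qL /ffunP e] := LP (l, b) fi.
exists q => //; have fq := Lfi q qL; apply: (facet_ineq_scale fq fi) => x Qx qx.
have : (Q `&` [set x | dot q.1 x = q.2]) x by [].
case: fq => v _ _ _; move: v; rewrite Qs => v; rewrite conv_seq_face //.
apply: eq_dot_conv => y /=; rewrite mem_filter => /andP[qy ys].
have iy : (index y s < size s)%N by rewrite index_mem.
by have := e (Ordinal iy); rewrite !ffunE /= nth_index // qy => /esym/eqP.
Qed.

Lemma small_step Q p d : polytope Q -> exists2 e, 0 < e &
  forall l b, facet_ineq Q l b -> dot l p < b -> dot l (p + e *: d) < b.
Proof.
move=> /facet_ineq_finite[L [Lfi LP]].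
have [|e e0 he] := @ex_small _ _ L
  (* The value 1 is a positive filler for the inequalities that are not strict at [p]. *)
  (fun q => if dot q.1 p < q.2 then q.2 - dot q.1 p else 1) (fun q => dot q.1 d).
  by move=> q _; case: ifP => //; rewrite subr_gt0.
exists e => // l b fi; have [q qL [c c0 [-> ->]]] := LP l b fi.
rewrite !dotZl !ltr_pM2l // => lp; have := he q qL; rewrite lp !dotE; lra.
Qed.

Definition interior_pt Q q := forall l b, facet_ineq Q l b -> dot l q < b.

(** A nonzero valid functional tight at [q] could be rotated into a facet inequality tight at [q];
    the point violated is the reflection in [q] of a strict point [c]. *)
Lemma interior_valid Q q l b : polytope Q -> full Q -> Q q -> interior_pt Q q ->
  valid Q l b -> dot l q = b -> l = 0.
Proof.
move=> pQ fQ Qq iq v lq; apply/eqP/negPn/negP => /(full_lt fQ v)[c Qc lc].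
have [|l' [b' [/iq lt /(_ q Qq lq) e _]]] := facet_violated (x := q + (q - c)) pQ fQ v Qq lq.
  by rewrite !dotE; lra.
by rewrite e ltxx in lt.
Qed.

Lemma interior_ptP Q : polytope Q -> Q !=set0 -> exists2 c, Q c & interior_pt Q c.
Proof.
move=> pQ /(relint_point pQ)[c Qc hc]; exists c => // l b [v [x Qx lx] _ _].
by rewrite lt_neqAle v // andbT; apply/eqP => /(hc _ _ v)/(_ x Qx) e; rewrite e ltxx in lx.
Qed.

End Facets.

(** * Affine hulls and dimension *)

Section Affine.
Context {R : realFieldType} {m : nat}.
Implicit Types (A B Q F G : set 'rV[R]_m) (x y z p l u v a : 'rV[R]_m) (b c t : R)
  (s : seq 'rV[R]_m) (U : {vspace 'rV[R]_m}).

Lemma sub_aff A : A `<=` aff A.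
Proof.
by move=> x Ax; exists 1%N, (fun=> x), (fun=> 1); split=> //; rewrite big_ord1 ?scale1r.
Qed.

Lemma aff_mono A B : A `<=` B -> aff A `<=` aff B.
Proof. by move=> AB x [k [p [c [Ap c1 ->]]]]; exists k, p, c; split=> // i; apply: AB. Qed.

Lemma eq_dot_aff A l b :
  (forall x, A x -> dot l x = b) -> forall x, aff A x -> dot l x = b.
Proof.
move=> h _ [k [p [c [Ap c1 ->]]]]; rewrite dot_sumr.
under eq_bigr do rewrite dotZr h //.
by rewrite -mulr_suml c1 mul1r.
Qed.

Lemma affine_comb_vspace U a k (p : 'I_k -> 'rV[R]_m) (c : 'I_k -> R) :
  (forall i, p i - a \in U) -> \sum_i c i = 1 -> \sum_i c i *: p i - a \in U.
Proof.
move=> pU c1; rewrite -[X in _ - X]scale1r -c1 scaler_suml -sumrB.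
by apply: memv_suml => i _; rewrite -scalerBr memvZ.
Qed.

(** The direction space is spanned by the differences of the generators with [a]; in the converse,
    the weight of [a] brings the sum to 1. *)
Lemma aff_vspace A a : polytope A -> A a ->
  exists U, aff A = [set a + u | u in [set` U]].
Proof.
move=> [s ->] sa; pose X := [seq x - a | x <- s]; exists <<X>>%VS.
apply/seteqP; split=> [_ [k [p [c [Ap c1 ->]]]]|_ [u /= uX <-]].
  exists (\sum_i c i *: p i - a); last by rewrite subrKC.
  apply: affine_comb_vspace => // i; have [k' [p' [c' [sp' _ c1' ->]]]] := Ap i.
  by apply: affine_comb_vspace => // j; apply/memv_span/map_f/sp'.
pose d i := coord (in_tuple X) i u.
exists (size X).+1, (fun i => if unlift ord0 i is Some j then s`_j else a),
  (fun i => if unlift ord0 i is Some j then d j else 1 - \sum_j d j); split.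
- move=> i; case: (unlift _ i) => [j|//]; apply: sub_conv; apply: mem_nth.
  by apply: leq_trans (ltn_ord j) _; rewrite size_map.
- rewrite big_ord_recl unlift_none; under [X in _ + X]eq_bigr do rewrite liftK.
  by rewrite subrK.
- rewrite big_ord_recl unlift_none; under [X in _ = _ + X]eq_bigr do rewrite liftK.
  rewrite {1}(coord_span (X := in_tuple X) uX) scalerBl scale1r -addrA; congr (a + _).
  rewrite addrC scaler_suml -sumrB; apply: eq_bigr => i _; rewrite -scalerBr /=.
  by rewrite (nth_map 0) //; apply: leq_trans (ltn_ord i) _; rewrite size_map.
Qed.

Lemma translate_vspace_sub a a' U U' :
  [set a + u | u in [set` U]] `<=` [set a' + u | u in [set` U']] -> (U <= U')%VS.
Proof.
move=> sub; have [u0 u0U e0] := sub a (ex_intro2 _ _ 0 (mem0v U) (addr0 a)).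
apply/subvP => u uU; have [u' u'U] := sub (a + u) (ex_intro2 _ _ u uU erefl).
by rewrite -e0 -addrA => /addrI e; rewrite -(addKr u0 u) -e addrC memvB.
Qed.

(** The direction space of an affine hull is unique, so the choice made by [xget] does not
    matter. *)
Lemma aff_dimE A a U : aff A = [set a + u | u in [set` U]] -> aff_dim A = (\dim U)%:Z.
Proof.
move=> e; rewrite /aff_dim; case: xgetP => [_ _ [a' [U' [e' ->]]]|/(_ (\dim U)%:Z)[]].
  congr Posz; apply/eqP; rewrite eqn_leq; apply/andP.
  by split; apply: dimvS; [apply: (@translate_vspace_sub a' a)|apply: (@translate_vspace_sub a a')];
    rewrite -e -e'.
by exists a, U.
Qed.

(** A coordinate in which [x] differs from its projection to [U] gives the functional. *)
Lemma vspace_separation U x : x \notin U ->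
  exists l, (forall u, u \in U -> dot l u = 0) /\ dot l x != 0.
Proof.
move=> xU; pose f y := y - projv U y.
have [j fj] : exists j, f x 0 j != 0.
  apply/rV0Pn; rewrite subr_eq0; apply: contra xU => /eqP ->; exact: memv_proj.
pose g (y : 'rV[R]_m) : R^o := f y 0 j.
have g_lin : linear g.
  by move=> c y z; rewrite /g /f linearP opprD addrACA -scalerBr !mxE.
pose gL : {linear 'rV[R]_m -> R^o} := HB.pack g (GRing.isLinear.Build _ _ _ _ g g_lin).
have [l e] := linear_dot gL; exists l; split=> [u uU|]; rewrite -e //=.
by rewrite /g /f projv_id // subrr mxE.
Qed.

(** With equal dimensions the affine hulls would coincide, so [G] would lie in the hyperplane that
    cuts out [F]. *)
Lemma aff_dim_face_lt Q F G : polytope Q -> face Q F -> face Q G ->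
  F !=set0 -> F `<=` G -> F <> G -> aff_dim F < aff_dim G.
Proof.
move=> pQ fF fG [a Fa] FG nFG.
have [U eU] := aff_vspace (polytope_face pQ fF) Fa.
have [W eW] := aff_vspace (polytope_face pQ fG) (FG _ Fa).
have UW : (U <= W)%VS.
  by apply: (@translate_vspace_sub a a); rewrite -eU -eW; apply: aff_mono.
rewrite (aff_dimE eU) (aff_dimE eW) ltz_nat ltn_neqAle dimvS // andbT.
apply/negP => dUW; apply: nFG; apply/seteqP; split=> // y Gy.
have eUW : U = W by apply/eqP; rewrite eqEdim UW (eqP dUW) leqnn.
case: fF eU => l [b [v ->]]; set F' := _ `&` _ => eU.
split; first exact: (face_sub fG).
by apply: (@eq_dot_aff F') => [z [] //|]; rewrite eU eUW -eW; apply: sub_aff.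
Qed.

Lemma full_aff Q : polytope Q -> full Q -> Q !=set0 -> aff Q = setT.
Proof.
move=> pQ fQ [a Qa]; have [U e] := aff_vspace pQ Qa; rewrite e.
apply/seteqP; split=> // x _; exists (x - a); last by rewrite subrKC.
apply: contrapT => /negP/vspace_separation[l [lU]].
suff -> : l = 0 by rewrite dot0l eqxx.
apply: (fQ _ (dot l a)) => y /sub_aff; rewrite e => -[u uU <-].
by rewrite dotDr (lU _ uU) addr0.
Qed.

Lemma full_aff_dim Q : polytope Q -> full Q -> Q !=set0 -> aff_dim Q = m%:Z.
Proof.
move=> pQ fQ Q0; suff /aff_dimE -> : aff Q = [set 0 + u | u in [set` fullv]].
  by rewrite dimvf /dim /= mul1n.
rewrite full_aff //; apply/seteqP; split=> // x _.
by exists x; rewrite ?add0r //= memvf.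
Qed.

Lemma dim_hyperplane l U : l != 0 -> (forall u, u \in U <-> dot l u = 0) ->
  (\dim U).+1 = m.
Proof.
move=> l0 h; pose g (y : 'rV[R]_m) : R^o := dot l y.
have g_lin : linear g by move=> c y z; rewrite /g !dotE.
pose gL : {linear 'rV[R]_m -> R^o} := HB.pack g (GRing.isLinear.Build _ _ _ _ g g_lin).
have kU : lker (linfun gL) = U.
  apply/vspaceP => u; rewrite memv_ker lfunE /=.
  by apply/eqP/idP => /h.
suff e1 : \dim (linfun gL @: fullv)%VS = 1%N.
  have := limg_ker_dim (linfun gL) fullv.
  by rewrite capfv kU dimvf e1 addn1 /dim /= mul1n.
apply/eqP; rewrite eqn_leq; apply/andP; split.
  by rewrite (leq_trans (dimvS (subvf _))) // dimvf.
rewrite lt0n dimv_eq0; apply/eqP => e.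
have : linfun gL l \in (linfun gL @: fullv)%VS by rewrite memv_img ?memvf.
by rewrite e memv0 lfunE /= /g gt_eqF // dot_gt0.
Qed.

Lemma aff0 : aff (@set0 'rV[R]_m) = set0.
Proof.
apply/seteqP; split=> // x [[|k] [p [c [p0 c1 _]]]]; last by case: (p0 ord0).
by move/eqP: c1; rewrite big_ord0 eq_sym oner_eq0.
Qed.

Lemma aff_dim0 : aff_dim (@set0 'rV[R]_m) = -1.
Proof.
apply: xgetPN => d [a [U [e _]]]; have : aff (@set0 'rV[R]_m) a.
  by rewrite e; exists 0; [exact: mem0v|rewrite addr0].
by rewrite aff0.
Qed.

Lemma facet_ineq_facet Q l b : polytope Q -> full Q -> facet_ineq Q l b ->
  facet Q (Q `&` [set x | dot l x = b]) /\
  aff (Q `&` [set x | dot l x = b]) = [set x | dot l x = b].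
Proof.
move=> pQ fQ [v [w Qw lw] [g Qg lg] ext]; set F := Q `&` _.
have l0 : l != 0 by apply/eqP => l0; move: lw; rewrite -lg l0 !dot0l ltxx.
have fF : face Q F by exists l, b.
have [U e] := aff_vspace (polytope_face pQ fF) (conj Qg lg).
have hU u : u \in U <-> dot l u = 0.
  split=> [uU|lu].
    have : dot l (g + u) = b.
      by apply: (@eq_dot_aff F) => [y []//|]; rewrite e; exists u.
    by rewrite dotDr lg; lra.
  (* A functional vanishing on [U] is constant on the face, hence a multiple of [l], hence zero at
     [u]. *)
  apply: contrapT => /negP/vspace_separation[l' [l'U]].
  have [|c ->] := ext l' (dot l' g); last by rewrite dotZl lu mulr0 eqxx.
  move=> y Qy ly; have : aff F y by apply: sub_aff.
  by rewrite e => -[u' u'U <-]; rewrite dotDr (l'U _ u'U) addr0.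
split; last first.
  rewrite e; apply/seteqP; split=> [_ [u /hU lu <-]|x /= lx] /=.
    by rewrite dotDr lu addr0.
  by exists (x - g); [apply/hU; rewrite !dotE lx lg subrr|rewrite subrKC].
split=> //; rewrite (aff_dimE e) full_aff_dim //; last by exists g.
have := dim_hyperplane l0 hU; move: (\dim U) => k; lia.
Qed.

Lemma facet_facet_ineq Q G l b : (0 < m)%N -> polytope Q -> full Q -> Q !=set0 ->
  facet Q G -> aff G = [set x | dot l x = b] -> valid Q l b ->
  facet_ineq Q l b /\ G = Q `&` [set x | dot l x = b].
Proof.
move=> m0 pQ fQ Q0 [fG dG] aG v.
have eG : G = Q `&` [set x | dot l x = b].
  apply/seteqP; split=> [y Gy|y [Qy]].
    by split; [apply: face_sub Gy|rewrite -aG; apply: sub_aff].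
  rewrite -aG; case: fG => l' [b' [_ ->]] h; split=> //=.
  by apply: eq_dot_aff h => z [].
have [c Qc lc] : exists2 c, Q c & dot l c < b.
  apply: contrapT => h; have lQ : forall y, Q y -> dot l y = b.
    move=> y Qy; apply/le_anti; rewrite v //= leNgt; apply/negP => ly.
    by apply: h; exists y.
  have GQ : G = Q by rewrite eG; apply/seteqP; split=> [y []//|y Qy]; split=> //; exact: lQ.
  by move: dG; rewrite GQ => /eqP; rewrite eq_sym subr_eq addrC -subr_eq subrr.
(* If [l = 0], then [0 < b] and [G] is empty. Its dimension is the default -1, which differs from
   [m - 1] because [0 < m]. *)
have l0 : l != 0.
  apply/eqP => l0; move: lc; rewrite l0 dot0l => b0.
  have G0 : G = set0.
    by rewrite eG; apply/seteqP; split=> // y [_ /=]; rewrite l0 dot0l => e; rewrite e ltxx in b0.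
  by move: dG; rewrite G0 aff_dim0 full_aff_dim //; lia.
split=> //; split=> //; first by exists c.
  apply: contrapT => h; have G0 : G = set0.
    by rewrite eG; apply/seteqP; split=> // y [Qy ly]; apply: h; exists y.
  have : aff G ((b / dot l l) *: l).
    by rewrite aG /= dotZr mulfVK // gt_eqF // dot_gt0.
  by rewrite G0 aff0.
move=> l' b' sub; apply: dot_scalar_mult => // u lu.
have h y : dot l y = b -> dot l' y = b'.
  move=> ly; apply: (@eq_dot_aff G); last by rewrite aG.
  by move=> z; rewrite eG => -[Qz]; apply: sub.
have [x lx] : exists x, dot l x = b.
  by exists ((b / dot l l) *: l); rewrite dotZr mulfVK // gt_eqF // dot_gt0.
have := h (x + u); rewrite !dotDr lx lu addr0 (h x lx) => /(_ erefl); lra.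
Qed.

End Affine.

(** * Stellar subdivision *)

Section Stellar.
Context {R : realFieldType} {m : nat}.
Implicit Types (A B Q F G H K X : set 'rV[R]_m) (x y z p l u v a : 'rV[R]_m) (b c t : R).

Definition beyond_ineq Q F v := forall l b, facet_ineq Q l b ->
  ((forall y, F y -> dot l y = b) -> b < dot l v) /\
  (~ (forall y, F y -> dot l y = b) -> dot l v < b).

Lemma beyond_beyond_ineq Q F v : polytope Q -> full Q -> F `<=` Q ->
  beyond Q F v -> beyond_ineq Q F v.
Proof.
move=> pQ fQ FQ bv l b fi; have [fG aG] := facet_ineq_facet pQ fQ fi.
case: (fi) => vQ _ _ _; have [h1 h2] := bv _ _ _ fG aG vQ.
split=> [Fl|nFl]; first by apply: h1 => y Fy; split; [apply: FQ|apply: Fl].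
by apply: h2 => FG; apply: nFl => y /FG[].
Qed.

(** Move a relative interior point of [F] slightly away from an interior point of [Q]: facets
    through [F] become violated, the others stay strict. *)
Lemma beyond_exists Q F : (0 < m)%N -> polytope Q -> full Q ->
  face Q F -> F !=set0 -> exists v, beyond Q F v.
Proof.
move=> m0 pQ fQ fF F0; have Q0 : Q !=set0 by case: F0 => x /(face_sub fF); exists x.
have [p Fp relp] := relint_point (polytope_face pQ fF) F0.
have [c Qc intc] := interior_ptP pQ Q0.
have [e e0 he] := small_step p (p - c) pQ.
exists (p + e *: (p - c)) => G l b fG aG vl.
have [fi ->] := facet_facet_ineq m0 pQ fQ Q0 fG aG vl.
have lc := intc _ _ fi; split=> [FG|nFG].
  have [_ /= lp] := FG _ Fp; rewrite !dotE lp.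
  by have := mulr_gt0 e0 (_ : 0 < b - dot l c); rewrite subr_gt0 => /(_ lc); lra.
apply: he => //; rewrite lt_neqAle vl ?andbT; last exact: face_sub Fp.
apply/eqP => lp; apply: nFG => y Fy; split; first exact: face_sub Fy.
by apply: relp lp y Fy => z /(face_sub fF)/vl.
Qed.

Variables (Q F : set 'rV[R]_m) (v : 'rV[R]_m).
Hypotheses (m0 : (0 < m)%N) (pQ : polytope Q) (fQ : full Q) (fF : face Q F).
Hypotheses (F0 : F !=set0) (FQ : F <> Q) (bv : beyond_ineq Q F v).

Let Q0 : Q !=set0. Proof. by case: F0 => x /(face_sub fF); exists x. Qed.

Lemma full_conv_sub A B : full A -> A `<=` B -> full B.
Proof. by move=> fA AB l b h; apply: (fA l b) => x /AB/h. Qed.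

Lemma full_stellar : full (conv (Q `|` [set v])).
Proof. by apply: full_conv_sub fQ _ => x Qx; apply: sub_conv; left. Qed.

(* A point of [F] lies strictly between an interior point of [Q] and [v]. *)
Lemma beyond_gt l b : valid Q l b -> (forall y, F y -> dot l y = b) ->
  (exists2 c, Q c & dot l c < b) -> b < dot l v.
Proof.
move=> vl Fl [c Qc lc].
have [p Fp relp] := relint_point (polytope_face pQ fF) F0.
have [e e0 he] := small_step p (p - v) pQ; set q := _ + _ in he.
have lq l' : dot l' q = dot l' p + e * (dot l' p - dot l' v) by rewrite !dotE.
have iq : interior_pt Q q.
  move=> l' b' fi; case: (fi) => v' _ _ _.
  have [lp|lp] := ltP (dot l' p) b'; first exact: he.
  have {}lp : dot l' p = b' by apply/le_anti; rewrite lp v' //; apply: face_sub Fp.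
  have Fl' : forall y, F y -> dot l' y = b'.
    by apply: relp lp => y /(face_sub fF)/v'.
  have [/(_ Fl') lv _] := bv fi; rewrite lq lp.
  by have := mulr_gt0 e0 (_ : 0 < dot l' v - b'); rewrite subr_gt0 => /(_ lv); lra.
have Qq : Q q by apply: facet_hrep => // l' b' /iq/ltW.
rewrite ltNge; apply/negP => lv; have : dot l q = b.
  apply/le_anti; rewrite vl //= lq Fl // lerDl mulr_ge0 ?(ltW e0) //; lra.
move=> lqb; have l0 := interior_valid pQ fQ Qq iq vl lqb.
by move: lc; rewrite -lqb l0 !dot0l ltxx.
Qed.

(** Some facet contains [H] but not [F], so [v] is strict for it. Adding a large multiple of its
    inequality to one defining [H] makes [v] strict without changing the face. *)
Lemma face_beyond_lt H : face Q H -> ~ F `<=` H ->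
  exists l b, [/\ valid Q l b, H = Q `&` [set x | dot l x = b] & dot l v < b].
Proof.
move=> fH nFH; have [z Fz nHz] : exists2 z, F z & ~ H z.
  by apply: contrapT => h; apply: nFH => z Fz; apply: contrapT => nz; apply: h; exists z.
have [l1 [b1 [fi Hl1 l1z]]] := face_facet_avoid m0 pQ fQ fH (face_sub fF Fz) nHz.
have l1v : dot l1 v < b1.
  by apply: (bv fi).2 => /(_ z Fz) e; rewrite e ltxx in l1z.
case: fH Hl1 => l0 [b0 [vl0 ->]] Hl1; case: fi => vl1 _ _ _.
have d0 : 0 < b1 - dot l1 v by rewrite subr_gt0.
(* [N] is large enough for the slack of [v] in [l1] to outweigh its possible excess in [l0]. *)
pose N := (`|dot l0 v - b0| + 1) / (b1 - dot l1 v).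
have N0 : 0 < N by rewrite divr_gt0 // ltr_wpDl.
have sE y : dot (l0 + N *: l1) y = dot l0 y + N * dot l1 y by rewrite !dotE.
have h1 y : Q y -> N * dot l1 y <= N * b1 by move=> /vl1; rewrite ler_pM2l.
exists (l0 + N *: l1), (b0 + N * b1); split.
- by move=> y Qy; rewrite sE lerD ?h1 //; apply: vl0.
- apply/seteqP; split=> y [Qy /= e]; split=> //=; rewrite ?sE ?e ?Hl1 //.
  apply/le_anti; rewrite vl0 //=; have := h1 y Qy; move: e; rewrite sE; lra.
- rewrite sE; have : N * (b1 - dot l1 v) = `|dot l0 v - b0| + 1.
    by rewrite /N divfK // gt_eqF.
  by have := ler_norm (dot l0 v - b0); lra.
Qed.

Lemma beyond_notin : ~ Q v.
Proof.
have [l [b [fi Fl]]] := face_in_facet m0 pQ fQ fF FQ.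
have /= := (bv fi).1 Fl; case: fi => vl _ _ _ + /vl; lra.
Qed.

Lemma stellar_vertex : conv (Q `|` [set v]) v.
Proof. by apply: sub_conv; right. Qed.

Lemma validU l b : valid Q l b -> dot l v <= b -> valid (Q `|` [set v]) l b.
Proof. by move=> vl lv x [/vl //|->]. Qed.

Lemma stellar_face_old H : face Q H -> ~ F `<=` H ->
  face (conv (Q `|` [set v])) H /\ H <> conv (Q `|` [set v]).
Proof.
move=> fH nFH; have [l [b [vl eH lv]]] := face_beyond_lt fH nFH.
have vU := validU vl (ltW lv); split; last first.
  by move=> e; apply: beyond_notin; apply: (face_sub fH); rewrite e; apply: stellar_vertex.
exists l, b; split; first exact: valid_conv.
rewrite conv_face // -[LHS](conv_polytope (polytope_face pQ fH)); congr conv.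
rewrite eH; apply/seteqP; split=> y [] => [Qy ly|[Qy|->] /= ly] //; first by split=> //; left.
by rewrite ly ltxx in lv.
Qed.

Lemma stellar_face_new H K : face Q H -> ~ F `<=` H ->
  face Q K -> K <> Q -> F `<=` K -> H `<=` K ->
  face (conv (Q `|` [set v])) (conv (H `|` [set v])) /\
  conv (H `|` [set v]) <> conv (Q `|` [set v]).
Proof.
move=> fH nFH fK KQ FK HK; have [l [b [vl eH lv]]] := face_beyond_lt fH nFH.
have [l1 [b1 [fi Kl1]]] := face_in_facet m0 pQ fQ fK KQ.
have l1v : b1 < dot l1 v by apply: (bv fi).1 => y /FK/Kl1.
case: fi => vl1 [c Qc lc] _ _.
(* [v] is strict for [l] and violates [l1]; weighting each inequality by the gap of the other puts
   [v] exactly on the combined hyperplane. *)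
pose s := dot l1 v - b1; pose t := b - dot l v.
have s0 : 0 < s by rewrite subr_gt0.
have t0 : 0 < t by rewrite subr_gt0.
pose L := s *: l + t *: l1; pose B := s * b + t * b1.
have LE y : dot L y = s * dot l y + t * dot l1 y by rewrite !dotE.
have Lv : dot L v = B by rewrite LE /B /s /t; ring.
have h y : Q y -> s * dot l y <= s * b by move=> /vl; rewrite ler_pM2l.
have h1 y : Q y -> t * dot l1 y <= t * b1 by move=> /vl1; rewrite ler_pM2l.
have vL : valid Q L B by move=> y Qy; rewrite LE lerD ?h ?h1.
have eHv : (Q `|` [set v]) `&` [set x | dot L x = B] = H `|` [set v].
  rewrite eH; apply/seteqP; split=> y.
    move=> [[Qy|->] /= e]; [left; split=> //=|by right].
    apply/(mulfI (lt0r_neq0 s0))/le_anti; rewrite h //=.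
    by have := h1 y Qy; move: e; rewrite LE /B; lra.
  move=> [[Qy ly]|->]; last by split=> //; right.
  split; [by left|rewrite /= LE ly Kl1 //].
  by apply: HK; rewrite eH.
have vU : valid (Q `|` [set v]) L B by apply: validU => //; rewrite Lv.
split; first by exists L, B; rewrite conv_face // eHv; split=> //; apply: valid_conv.
move=> e; have : conv (H `|` [set v]) c by rewrite e; apply: sub_conv; left.
rewrite -eHv -conv_face // => -[_ /=]; rewrite LE /B.
have := h c Qc; have : t * dot l1 c < t * b1 by rewrite ltr_pM2l.
lra.
Qed.

(** A supporting functional of the new polytope is either strict at [v], which gives an old face, or
    tight at [v], which gives a cone over the face [H] it cuts from [Q]. *)
Lemma stellar_faceP X : face (conv (Q `|` [set v])) X -> X <> conv (Q `|` [set v]) ->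
  exists H, [/\ face Q H, ~ F `<=` H &
    X = H \/ X = conv (H `|` [set v]) /\
      exists K, [/\ face Q K, K <> Q, F `<=` K & H `<=` K]].
Proof.
move=> [l [b [vl' eX]]] XQ'.
have vU : valid (Q `|` [set v]) l b by move=> y ?; apply/vl'/sub_conv.
have vl : valid Q l b by move=> y ?; apply: vU; left.
have lv : dot l v <= b by apply: vU; right.
rewrite conv_face // in eX.
pose H := Q `&` [set x | dot l x = b]; have fH : face Q H by exists l, b.
move: lv; rewrite le_eqVlt => /orP[/eqP lv|lv]; last first.
  have eH : (Q `|` [set v]) `&` [set x | dot l x = b] = H.
    apply/seteqP; split=> [y [[Qy|->]] //= ly|y [Qy ly]]; last by split=> //; left.
    by rewrite ly ltxx in lv.
  exists H; split=> // [FH|]; last by left; rewrite eX eH conv_polytope //; apply: polytope_face fH.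
  have := lv; rewrite ltNge => /negP; apply; apply/ltW/beyond_gt => // [y /FH[]//|].
  apply: full_lt => //; apply/eqP => l0; case: F0 => y /FH[_ /=].
  by rewrite l0 dot0l => b0; move: lv; rewrite l0 dot0l b0 ltxx.
have eH : (Q `|` [set v]) `&` [set x | dot l x = b] = H `|` [set v].
  apply/seteqP; split=> y; first by move=> [[Qy|->]] ly; [left|right].
  by move=> [[Qy ly]|->]; split=> //; [left|right].
rewrite eH in eX.
have [c Qc lc] : exists2 c, Q c & dot l c < b.
  apply: contrapT => h; apply: XQ'; rewrite eX; congr (conv (_ `|` _)).
  apply/seteqP; split=> [y []//|y Qy]; split=> //=.
  by apply/le_anti; rewrite vl //= leNgt; apply/negP => ly; apply: h; exists y.
have nFH : ~ F `<=` H.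
  move=> FH; have : b < dot l v by apply: beyond_gt => // [y /FH[]//|]; exists c.
  by rewrite lv ltxx.
exists H; split=> //; right; split=> //.
have [H0|H0] := pselect (H !=set0); last first.
  by exists F; split=> // y Hy; case: H0; exists y.
apply: contrapT => nK.
have [p Hp relp] := relint_point (polytope_face pQ fH) H0.
(* If no proper face contained both [F] and [H], every facet through [H] would be strict at [v]. A
   small step from [p] towards [v] would then reach the interior of [Q] although [l] keeps the value
   [b]. *)
have [e e0 he] := small_step p (v - p) pQ; set q := _ + _ in he.
have lq l' : dot l' q = dot l' p + e * (dot l' v - dot l' p) by rewrite !dotE.
have iq : interior_pt Q q.
  move=> l' b' fi; case: (fi) => v' [c' Qc' lc'] _ _.
  have [lp|lp] := ltP (dot l' p) b'; first exact: he.
  have {}lp : dot l' p = b' by apply/le_anti; rewrite lp v' //; case: Hp.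
  have Hl' : forall y, H y -> dot l' y = b'.
    by apply: relp lp => y []/v'.
  have lv' : dot l' v < b'.
    apply: (bv fi).2 => Fl'; apply: nK; exists (Q `&` [set x | dot l' x = b']); split.
    - by exists l', b'.
    - move=> eQ; have : (Q `&` [set x | dot l' x = b']) c' by rewrite eQ.
      by move=> [_ /= e']; rewrite e' ltxx in lc'.
    - by move=> y Fy; split; [apply: face_sub Fy|apply: Fl'].
    - by move=> y Hy; split; [case: Hy|apply: Hl'].
  rewrite lq lp.
  by have := mulr_gt0 e0 (_ : 0 < b' - dot l' v); rewrite subr_gt0 => /(_ lv'); lra.
have Qq : Q q by apply: facet_hrep => // l' b' /iq/ltW.
have lqb : dot l q = b by rewrite lq lv; case: Hp => _ /= ->; rewrite subrr mulr0 addr0.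
have l0 := interior_valid pQ fQ Qq iq vl lqb.
by move: lc; rewrite -lv l0 !dot0l ltxx.
Qed.

(** A facet through [K] separates: on it lies [H], on one side [Q], strictly on the other [v]. So
    the cone over [H] meets [Q] only in [H]. *)
Lemma stellar_join_old H K x : face Q H -> face Q K -> K <> Q -> F `<=` K -> H `<=` K ->
  Q x -> conv (H `|` [set v]) x -> H x.
Proof.
move=> fH fK KQ FK HK Qx Hx.
have [l [b [fi Kl]]] := face_in_facet m0 pQ fQ fK KQ.
have lv : b < dot l v by apply: (bv fi).1 => y /FK/Kl.
case: fi => vl _ _ _.
have vN : valid (H `|` [set v]) (- l) (- b).
  by move=> y [/HK/Kl <-|->]; rewrite dotNl lerN2 //; apply: ltW.
have lx : dot (- l) x = - b.
  by apply/le_anti; rewrite (valid_conv vN) //= dotNl lerN2 vl.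
have : (conv (H `|` [set v]) `&` [set y | dot (- l) y = - b]) x by [].
rewrite conv_face // -[X in _ -> X x](conv_polytope (polytope_face pQ fH)).
apply: conv_mono => y [[//|->]] /=; rewrite dotNl => /oppr_inj e.
by rewrite e ltxx in lv.
Qed.

End Stellar.

(** * Polars and pyramids *)

Section AffineImage.
Context {R : realFieldType} {m n : nat} (f : 'rV[R]_m -> 'rV[R]_n).
Hypothesis f_affine : forall k (c : 'I_k -> R) p,
  \sum_i c i = 1 -> f (\sum_i c i *: p i) = \sum_i c i *: f (p i).

Lemma conv_image A : f @` conv A = conv (f @` A).
Proof.
apply/seteqP; split=> [_ [_ [k [p [c [Ap c0 c1 ->]]]] <-]|_ [k [p [c [Ap c0 c1 ->]]]]].
  by exists k, (f \o p), c; split=> // [i|]; [exists (p i)|apply: f_affine].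
have /choice[p' p'P] i : exists x, A x /\ f x = p i by case: (Ap i) => x; exists x.
exists (\sum_i c i *: p' i); first by exists k, p', c; split=> // i; case: (p'P i).
by rewrite f_affine //; apply: eq_bigr => i _; case: (p'P i) => _ ->.
Qed.

Lemma polytope_image Q : polytope Q -> polytope (f @` Q).
Proof.
move=> [s ->]; exists (map f s); rewrite conv_image; congr conv.
apply/seteqP; split=> [_ [x xs <-]|y /mapP[x xs ->]]; first exact: map_f.
by exists x.
Qed.

End AffineImage.

Section Polar.
Context {R : realFieldType} {m : nat}.
Implicit Types (A B Q F G H K X : set 'rV[R]_m) (x y z p l u v a : 'rV[R]_m) (b c t : R).

(** For a convex set this says, without topology, that the origin is an interior point. *)
Definition absorbing A := forall u, exists2 e, 0 < e & A (e *: u).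

Lemma absorbing0 A : absorbing A -> A 0.
Proof. by move=> /(_ 0)[e _]; rewrite scaler0. Qed.

Lemma absorbing_valid A l b : absorbing A -> valid A l b -> l = 0 /\ 0 <= b \/ 0 < b.
Proof.
move=> aA vA; have := vA _ (absorbing0 aA); rewrite dot0r => b0.
have [->|l0] := eqVneq l 0; [by left|right].
have [e e0 /vA] := aA l; rewrite dotZr; apply: lt_le_trans.
by rewrite mulr_gt0 // dot_gt0.
Qed.

Lemma absorbing_full A : absorbing A -> full A.
Proof.
move=> aA l b h; apply/eqP/negPn/negP => /dot_gt0 l0.
have [e e0 /h] := aA l; rewrite -(h _ (absorbing0 aA)) dot0r dotZr => /eqP.
by rewrite mulf_eq0 !gt_eqF.
Qed.

Lemma valid_polar A l b : 0 < b -> valid A l b -> polar A (b^-1 *: l).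
Proof. by move=> b0 vl x /vl lx; rewrite dotZr dotC mulrC ler_pdivrMr ?mul1r. Qed.

(** Bipolar theorem: a functional separating [z] from [A], scaled to right-hand side 1, is a point
    of the polar. *)
Lemma polarK A : polytope A -> absorbing A -> polar (polar A) = A.
Proof.
move=> pA aA; apply/seteqP; split=> [z Az|x Ax y]; last by rewrite dotC; apply.
apply: contrapT => /(polytope_separation pA)[l [b [vl lz]]].
have [[l0 b0]|b0] := absorbing_valid aA vl.
  by move: lz; rewrite l0 dot0l ltNge b0.
have := Az _ (valid_polar b0 vl).
by rewrite dotZl mulrC ler_pdivrMr // mul1r leNgt lz.
Qed.

Lemma absorbing_polar A : polytope A -> absorbing A -> absorbing (polar A).
Proof.
move=> pA aA u; have [g Ag vg] := polytope_touch u pA (ex_intro _ _ (absorbing0 aA)).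
have d0 : 0 < 1 + `|dot u g| by rewrite ltr_wpDr.
exists (1 + `|dot u g|)^-1; first by rewrite invr_gt0.
move=> x /vg ux; rewrite dotZr [dot x u]dotC mulrC ler_pdivrMr //.
apply: (le_trans ux); rewrite mul1r.
by rewrite ler_wpDl // ler_norm.
Qed.

(* The vertices are the normals of the facets of [A], scaled to right-hand
   side 1; the origin is only needed in dimension 0, where there are none. *)
Lemma polytope_polar A : polytope A -> absorbing A -> polytope (polar A).
Proof.
move=> pA aA; have fA := absorbing_full aA.
have [L [Lfi LP]] := facet_ineq_finite pA.
have Lgt q : q \in L -> 0 < q.2.
  case/Lfi => vl [c _ lc] _ _; have [[l0 b0]|//] := absorbing_valid aA vl.
  by move: lc; rewrite l0 dot0l.
exists (0 :: [seq q.2^-1 *: q.1 | q <- L]); apply/seteqP; split; last first.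
  apply: conv_sub_convex => [y y' t Ay Ay' t0 t1 x Ax|y /=].
    by apply: (@convex_valid _ _ x 1 y y' t) => //; [apply: Ay|apply: Ay'].

  rewrite inE => /orP[/eqP ->|/mapP[q qL ->]].
    by move=> x _; rewrite dot0r ler01.
  by apply: valid_polar; [apply: Lgt|case: (Lfi q qL)].
move=> y Ay; apply: contrapT => /separation[x [b [vx xy]]].
have b0 : 0 <= b by rewrite -(dot0r x); apply/vx/sub_conv; rewrite /= inE eqxx.
(* As [b] may be zero, a value strictly between [b] and [dot x y] serves as divisor. The scaled [x]
   then satisfies all facet inequalities of [A]. *)
pose b' := (b + dot x y) / 2.
have bb' : b < b' by rewrite /b'; lra.
have b'y : b' < dot x y by rewrite /b'; lra.
have b'0 : 0 < b' by apply: le_lt_trans bb'.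
suff /Ay : A (b'^-1 *: x) by rewrite dotZl mulrC ler_pdivrMr // mul1r leNgt b'y.
apply: facet_hrep => // [|l c /LP[q qL [d d0 [-> ->]]]].
  by exists 0; apply: absorbing0.
rewrite dotZl ler_pM2l // dotZr mulrC ler_pdivrMr // mulrC.
have : dot x (q.2^-1 *: q.1) <= b'.
  by apply/ltW/(le_lt_trans _ bb')/vx/sub_conv; rewrite /= inE;
     apply/orP; right; apply/mapP; exists q.
by rewrite dotZr [dot x _]dotC [_^-1 * _]mulrC ler_pdivrMr // Lgt.
Qed.

(** The conjugate face; for empty [G] it is the whole polar. *)
Definition dual_face A G : set 'rV[R]_m :=
  polar A `&` [set y | forall x, G x -> dot x y = 1].

Lemma dual_face_anti A G H : G `<=` H -> dual_face A H `<=` dual_face A G.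
Proof. by move=> GH y [Ay Hy]; split=> // x /GH/Hy. Qed.

(** Equality at a relative interior point [p] of [G] forces equality on all of [G], so the
    functional [p] cuts out the dual face. *)
Lemma face_dual_face A G : polytope A -> face A G -> face (polar A) (dual_face A G).
Proof.
move=> pA fG; have [G0|G0] := pselect (G !=set0); last first.
  exists 0, 0; split=> [x _|]; first by rewrite dot0l.
  apply/seteqP; split=> y [Ay _]; split=> //=; first by rewrite dot0l.
  by move=> x Gx; case: G0; exists x.
have [p Gp relp] := relint_point (polytope_face pA fG) G0.
have Ap := face_sub fG Gp.
exists p, 1; split=> [y /(_ p Ap)//|]; apply/seteqP; split=> y [Ay h]; split=> //=.
  exact: h.
move=> x Gx; rewrite dotC; apply: relp => // [z /(face_sub fG)/Ay|].
  by rewrite dotC.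
by rewrite dotC.
Qed.

Lemma dual_faceK A G : polytope A -> absorbing A -> face A G ->
  dual_face (polar A) (dual_face A G) = G.
Proof.
move=> pA aA fG; rewrite /dual_face polarK //; apply/seteqP; split; last first.
  move=> x Gx; split=> [|y [_ /(_ x Gx)]]; first exact: (face_sub fG).
  by rewrite dotC.
case: fG => l [b [vl ->]] x [Ax h]; split=> //=.
have [[l0 b0]|b0] := absorbing_valid aA vl; last first.
  have := h (b^-1 *: l); rewrite dotZl mulrC => e.
  have /e /divr1_eq // : (polar A `&` [set y | forall z,
      (A `&` [set w | dot l w = b]) z -> dot z y = 1]) (b^-1 *: l).
  split; first exact: valid_polar.
  by move=> z [_ /= lz]; rewrite dotZr dotC lz mulVf // gt_eqF.
(* With [l = 0] and [b] nonzero the face is empty, so 0 belongs to its dual face, yet it cannot pair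
   to 1 with [x]. *)
rewrite l0 dot0l; apply: contrapT => bn.
have : dot 0 x = 1; last by rewrite dot0l => /eqP; rewrite eq_sym oner_eq0.
apply: h; split=> [z _|z [_ /=]]; first by rewrite dot0r ler01.
by rewrite l0 dot0l.
Qed.

End Polar.

(** * Faces of a pyramid *)

Section Pyramid.
Context {R : realFieldType} {n : nat}.
Variables (Q : set 'rV[R]_n) (apex : 'rV[R]_(n + 1)).
Hypotheses (pQ : polytope Q) (fQ : full Q) (Q0 : Q !=set0).
Hypothesis apexP : ~ aff (pyr_base Q) apex.
Implicit Types (G H : set 'rV[R]_n) (x l : 'rV[R]_n) (L X : 'rV[R]_(n + 1)).

Lemma row_mx0_affine k (c : 'I_k -> R) (p : 'I_k -> 'rV[R]_n) : \sum_i c i = 1 ->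
  row_mx (\sum_i c i *: p i) (0 : 'rV_1) = \sum_i c i *: row_mx (p i) (0 : 'rV_1).
Proof.
move=> _; elim/big_ind2: _ => [|_ x _ y <- <-|i _]; first by rewrite row_mx0.
  by rewrite add_row_mx addr0.
by rewrite scale_row_mx scaler0.
Qed.

Definition join_apex G := conv (pyr_base G `|` [set apex]).

Lemma polytope_pyr_base G : polytope G -> polytope (pyr_base G).
Proof. exact/polytope_image/row_mx0_affine. Qed.

Lemma pyr_base_sub G H : pyr_base G `<=` pyr_base H <-> G `<=` H.
Proof.
split=> [GH x Gx|GH _ [x Gx <-]]; last by exists x => //; apply: GH.
have [|y Hy /eq_row_mx[<- _]] // := GH (row_mx x 0); by exists x.
Qed.

Lemma pyr_baseE L x : dot L (row_mx x 0) = dot (lsubmx L) x.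
Proof. by rewrite -{1}(hsubmxK L) dot_row_mx dot0r addr0. Qed.

Lemma apex_height : rsubmx apex 0 0 != 0.
Proof.
apply/eqP => a0; apply: apexP.
have : aff Q (lsubmx apex) by rewrite full_aff.
move=> [k [p [c [Qp c1 e]]]].
exists k, (fun i => row_mx (p i) 0), c; split=> // [i|]; first by exists (p i).
rewrite -row_mx0_affine // -e -[LHS]hsubmxK; congr row_mx.
by apply/rowP => i; rewrite (ord1 i) a0 mxE.
Qed.

(** The apex has nonzero height, so a functional can be prescribed independently on the base and at
    the apex. *)
Lemma pyr_functional l t :
  exists L, (forall x, dot L (row_mx x 0) = dot l x) /\ dot L apex = t.
Proof.
exists (row_mx l (const_mx ((t - dot l (lsubmx apex)) / rsubmx apex 0 0))); split.
  by move=> x; rewrite pyr_baseE row_mxKl.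
rewrite -[X in dot _ X = _]hsubmxK dot_row_mx [X in _ + X]dotC dot_scalar mulrC.
by rewrite divfK ?subrKC ?apex_height.
Qed.

Lemma apex_notin : ~ pyr_base Q apex.
Proof. by move/sub_aff. Qed.

Lemma polytope_pyr : polytope (pyr Q apex).
Proof. exact/polytopeU1/polytope_pyr_base. Qed.

Lemma full_pyr : full (pyr Q apex).
Proof.
move=> L b h; have lQ : forall x, Q x -> dot (lsubmx L) x = b.
  by move=> x Qx; rewrite -pyr_baseE; apply/h/sub_conv; left; exists x.
have l0 := fQ lQ; have b0 : b = 0 by case: Q0 => x /lQ <-; rewrite l0 dot0l.
have : dot L apex = 0 by rewrite -b0; apply/h/sub_conv; right.
rewrite -{1}(hsubmxK L) -{1}(hsubmxK apex) dot_row_mx l0 dot0l add0r dot_sum big_ord1.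
move/eqP; rewrite mulf_eq0 (negPf apex_height) orbF => /eqP c0.
rewrite -(hsubmxK L) l0 (_ : rsubmx L = 0) ?row_mx0 //.
by apply/rowP => i; rewrite (ord1 i) c0 mxE.
Qed.

Lemma pyr_face_base G : face Q G -> face (pyr Q apex) (pyr_base G).
Proof.
move=> fG; case: (fG) => l [b [vl eG]].
(* The value [b - 1] keeps the apex off the supporting hyperplane. *)
have [L [Lb La]] := pyr_functional l (b - 1).
have vL : valid (pyr_base Q `|` [set apex]) L b.
  by move=> _ [[x /vl lx <-]|->]; rewrite ?Lb ?La //; lra.
exists L, b; split; first exact: valid_conv.
rewrite conv_face // -[LHS](conv_polytope (polytope_pyr_base (polytope_face pQ fG))).
congr conv; rewrite eG; apply/seteqP; split=> y.
  by move=> [x [Qx lx] <-]; split; [left; exists x|rewrite /= Lb].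
move=> [[[x Qx <-]|->] /=]; last by rewrite La => /eqP; rewrite lt_eqF // gtrBl.
by rewrite Lb => lx; exists x.
Qed.

Lemma pyr_face_join G : face Q G -> face (pyr Q apex) (join_apex G).
Proof.
move=> fG; case: (fG) => l [b [vl eG]].
have [L [Lb La]] := pyr_functional l b.
have vL : valid (pyr_base Q `|` [set apex]) L b.
  by move=> _ [[x /vl lx <-]|->]; rewrite ?Lb ?La.
exists L, b; split; first exact: valid_conv.
rewrite conv_face //; congr conv; rewrite eG; apply/seteqP; split=> y.
  move=> [[x [Qx lx] <-]|->]; split=> //=; [by left; exists x|by rewrite Lb|by right].
move=> [[[x Qx <-]|->] /=]; last by right.
by rewrite Lb => lx; left; exists x.
Qed.

Lemma pyr_faceP (X : set 'rV[R]_(n + 1)) : face (pyr Q apex) X ->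
  exists2 G, face Q G & X = pyr_base G \/ X = join_apex G.
Proof.
move=> [L [b [vL' ->]]].
have vL : valid (pyr_base Q `|` [set apex]) L b by move=> y ?; apply/vL'/sub_conv.
pose l := lsubmx L; pose G := Q `&` [set x | dot l x = b].
have fG : face Q G.
  by exists l, b; split=> // x Qx; rewrite -pyr_baseE; apply: vL; left; exists x.
exists G => //; rewrite conv_face //.
have : dot L apex <= b by apply: vL; right.
rewrite le_eqVlt => /orP[/eqP La|La]; [right|left].
  congr conv; apply/seteqP; split=> y.
    by move=> [[[x Qx <-]|->] /=]; [rewrite pyr_baseE => lx; left; exists x|right].
  by move=> [[x [Qx lx] <-]|->]; split=> //=; [left; exists x|rewrite pyr_baseE|right].
rewrite -[RHS](conv_polytope (polytope_pyr_base (polytope_face pQ fG))).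
congr conv; apply/seteqP; split=> y.
  move=> [[[x Qx <-]|->] /=]; last by move=> e; rewrite e ltxx in La.
  by rewrite pyr_baseE => lx; exists x.
by move=> [x [Qx lx] <-]; split=> //=; [left; exists x|rewrite pyr_baseE].
Qed.

(** The functional that is 0 on the base and -1 at the apex cuts [pyr_base G] out of the cone over
    [G]. *)
Lemma join_apex_base G x : face Q G -> join_apex G (row_mx x 0) -> G x.
Proof.
move=> fG Gx; have [L [Lb La]] := pyr_functional 0 (-1).
have vL : valid (pyr_base G `|` [set apex]) L 0.
  by move=> _ [[y _ <-]|->]; rewrite ?Lb ?La ?dot0l // lerN10.
have : (conv (pyr_base G `|` [set apex]) `&` [set y | dot L y = 0]) (row_mx x 0).
  by split; rewrite //= Lb dot0l.
rewrite conv_face // => h.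
have : pyr_base G (row_mx x 0).
  rewrite -(conv_polytope (polytope_pyr_base (polytope_face pQ fG))).
  apply: conv_mono h => y [[//|->]] /=; rewrite La => /eqP.
  by rewrite oppr_eq0 oner_eq0.
by move=> [y Gy /eq_row_mx[<-]].
Qed.

Lemma join_apex_apex G : join_apex G apex.
Proof. by apply: sub_conv; right. Qed.

Lemma pyr_base_join G H : face Q H -> pyr_base G `<=` join_apex H <-> G `<=` H.
Proof.
move=> fH; split=> [GH x Gx|/pyr_base_sub GH y /GH Hy].
  by apply: join_apex_base => //; apply: GH; exists x.
by apply: sub_conv; left.
Qed.

Lemma join_apex_sub G H : face Q H -> join_apex G `<=` join_apex H <-> G `<=` H.
Proof.
move=> fH; split=> [GH|/pyr_base_sub GH].
  by apply/(pyr_base_join _ fH) => y Gy; apply/GH/sub_conv; left.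
by apply: conv_mono => y [/GH|]; [left|right].
Qed.

End Pyramid.

(** * Iterated stellar subdivision *)

Section Subdivisions.
Context {R : realFieldType} {m : nat}.
Local Notation vset := (set 'rV[R]_m).
Implicit Types (Q F G H X Y B D : vset) (U S : set vset) (v : 'rV[R]_m).
Variable K : vset.
Hypotheses (m0 : (0 < m)%N) (pK : polytope K) (fK : full K).

(** [G = set0] and [S = set0] are allowed. A chain is kept as a set, since inclusion already orders
    its members. *)
Definition flag_pair U G S := [/\ face K G /\ G <> K, ~ U G, S `<=` U,
  forall X Y, S X -> S Y -> X `<=` Y \/ Y `<=` X & forall X, S X -> G `<=` X].

(* After the subdivisions at the faces in [U], the proper faces are the joins
   of a face [G] outside [U] with the new vertices of a chain [S] in [U]. *)
Record subdivided U Q (phi : vset -> set vset -> vset) : Prop := {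
  sub_polytope : polytope Q;
  sub_full : full Q;
  sub_face : forall G S, flag_pair U G S -> face Q (phi G S) /\ phi G S <> Q;
  sub_surj : forall X, face Q X -> X <> Q ->
    exists G S, flag_pair U G S /\ X = phi G S;
  sub_le : forall G S G' S', flag_pair U G S -> flag_pair U G' S' ->
    phi G S `<=` phi G' S' <-> G `<=` G' /\ S `<=` S';
  sub_old : forall G, flag_pair U G set0 -> phi G set0 = G }.

Lemma subdivided0 : subdivided set0 K (fun G _ => G).
Proof.
have S0 G S : flag_pair set0 G S -> S = set0.
  by move=> [_ _ S0 _ _]; apply/seteqP; split.
split=> // [G S []//|X fX XK|G S G' S' /S0 -> /S0 ->]; last first.
  by split=> [GG'|[]//]; split.
by exists X, set0; split=> //; split.
Qed.

Section Step.
Variables (U : set vset) (Q : vset) (phi : vset -> set vset -> vset).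
Variable F : vset.
Hypotheses (subQ : subdivided U Q phi) (fF : face K F) (F0 : F !=set0) (FK : F <> K).
Hypothesis UF : ~ U F.
(** The effect of decreasing dimension: proper faces strictly above [F] have been subdivided, and no
    face inside [F] has. *)
Hypothesis up : forall G, face K G -> G <> K -> F `<=` G -> G <> F -> U G.
Hypothesis down : forall X, U X -> ~ X `<=` F.

Let okF : flag_pair U F set0. Proof. by split. Qed.

Lemma next_face : face Q F /\ F <> Q.
Proof. by have := sub_face subQ okF; rewrite (sub_old subQ okF). Qed.

(** The faces of [Q] containing [F] come from the pairs [(F, S)], since any larger first component
    would already be in [U]. *)
Let F_sub G S : flag_pair U G S -> F `<=` phi G S -> G = F.
Proof.
move=> ok; rewrite -{1}(sub_old subQ okF) => /(sub_le subQ okF ok)[FG _].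
by case: ok => [[fG GK] nUG _ _ _]; apply: contrapT => GF; apply/nUG/up.
Qed.

Let sub_F S : flag_pair U F S -> F `<=` phi F S.
Proof. by move=> ok; rewrite -{1}(sub_old subQ okF); apply/(sub_le subQ okF ok); split. Qed.

Let U' := U `|` [set F].

Let ok_old G S : flag_pair U' G S -> ~ S F ->
  flag_pair U G S /\ ~ F `<=` phi G S.
Proof.
move=> [fG nUG SU cS GS] nSF.
have ok : flag_pair U G S.
  split=> // [UG|X SX]; first by apply: nUG; left.
  by case: (SU X SX) => // XF; move: SX; rewrite XF.
by split=> // /(F_sub ok) GF; apply: nUG; right.
Qed.

(** Removing [F] from the chain leaves an old face not containing [F]; [phi F (S \ F)] is the common
    proper face with [F] that a cone over it requires. *)
Let ok_new G S : flag_pair U' G S -> S F ->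
  [/\ flag_pair U G (S `\ F), ~ F `<=` phi G (S `\ F), flag_pair U F (S `\ F) &
     phi G (S `\ F) `<=` phi F (S `\ F)].
Proof.
move=> ok SF; have [okG nF] : flag_pair U G (S `\ F) /\ ~ F `<=` phi G (S `\ F).
  apply: ok_old; last by move=> [_]; apply.
  case: ok => [fG nUG SU cS GS]; split=> // [X []|X Y [+ _] [+ _]|X []] //.
  - by move=> /SU.
  - exact: cS.
  - by move=> /GS.
have okFS : flag_pair U F (S `\ F).
  case: ok okG => [_ _ _ cS _] [_ _ SU cS' _]; split=> // X [SX XF].
  have [//|/down []] := cS _ _ SF SX.
  by apply: SU.
split=> //; apply/(sub_le subQ okG okFS); split=> //.
by case: ok => _ _ _ _; apply.
Qed.

(** The new vertex [v] represents [F] in the chains: old faces correspond to chains without [F],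
    cones from [v] to chains with [F]. *)
Lemma subdivided_step v : beyond_ineq Q F v ->
  subdivided U' (conv (Q `|` [set v]))
    (fun G S => if `[< S F >] then conv (phi G (S `\ F) `|` [set v]) else phi G S).
Proof.
move=> bv; have [fQF FQ] := next_face.
have pQ := sub_polytope subQ; have fQ := sub_full subQ.
have phiQ G S : flag_pair U G S -> phi G S `<=` Q.
  by move=> /(sub_face subQ)[/face_sub].
have vQ := beyond_notin m0 pQ fQ fQF FQ bv.
split.
- exact: polytopeU1.
- exact: full_stellar.
- move=> G S ok; case: asboolP => SF.
    have [okG nF okFS sub] := ok_new ok SF.
    have [fG GQ] := sub_face subQ okG; have [fH HQ] := sub_face subQ okFS.
    exact: (stellar_face_new m0 pQ fQ fQF bv fG nF fH HQ (sub_F okFS) sub).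
  have [okG nF] := ok_old ok SF; have [fG GQ] := sub_face subQ okG.
  exact: (stellar_face_old m0 pQ fQ fQF FQ bv fG nF).
- move=> X fX XQ'.
  have [H [fH nFH hX]] := stellar_faceP pQ fQ fQF F0 FQ bv fX XQ'.
  have HQ : H <> Q by move=> HQ; apply: nFH; rewrite HQ; apply: face_sub.
  have [G [S [ok eH]]] := sub_surj subQ fH HQ.
  have GF : G <> F by move=> GF; apply: nFH; rewrite eH GF; apply: sub_F; rewrite -GF.
  have nSF : ~ S F by case: ok => _ _ SU _ _ /SU.
  case: (ok) => [fG nUG SU cS GS].
  case: hX => [->|[-> [L [fL LQ FL HL]]]].
    exists G, S; case: asboolP => // _; split=> //; split=> // [[//|//]|Y /SU]; by left.
  (* The common face [L] contains [F], so it comes from a pair [(F, S')]. As [S] is part of [S'],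
     all its members contain [F] and [F] can be added to the chain. *)
  have [G' [S' [ok' eL]]] := sub_surj subQ fL LQ.
  have G'F : G' = F by apply: F_sub ok' _; rewrite -eL.
  have [GF' SS'] : G `<=` G' /\ S `<=` S' by apply/(sub_le subQ ok ok'); rewrite -eH -eL.
  have FS' Y : S' Y -> F `<=` Y by case: ok' => _ _ _ _; rewrite G'F; apply.
  exists G, (S `|` [set F]); split; last first.
    rewrite /= asboolT; last by right.
    suff -> : (S `|` [set F]) `\ F = S by rewrite eH.
    apply/seteqP; split=> [Y [[|]//]|Y SY]; split; first by left.
    by move=> YF; move: SY; rewrite YF.
  split=> // [[//|//]|Y [/SU|->]|Y Z [SY|->] [SZ|->]|Y [/GS//|->]].
  - by left.
  - by right.
  - exact: cS.
  - by right; apply: (FS' _ (SS' _ _)).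
  - by left; apply: (FS' _ (SS' _ _)).
  - by left.
  - by rewrite -G'F.
- move=> G S G' S' ok ok'; case: asboolP => SF; case: asboolP => SF'.
  + have [okG nF okFS sub] := ok_new ok SF; have [okG' nF' okFS' sub'] := ok_new ok' SF'.
    have [fG' _] := sub_face subQ okG'; have [fH HQ] := sub_face subQ okFS'.
    have -> : G `<=` G' /\ S `<=` S' <-> G `<=` G' /\ S `\ F `<=` S' `\ F.
      split=> -[GG' SS']; split=> // X; first by move=> [/SS'].
      by move=> SX; have [->//|XF] := pselect (X = F); case: (SS' X).
    rewrite -(sub_le subQ okG okG'); split=> h.
      move=> x Gx; apply: (stellar_join_old m0 pQ fQ bv fG' fH HQ (sub_F okFS') sub').
        exact: phiQ Gx.
      by apply/h/sub_conv; left.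
    by apply: conv_mono => x [/h|]; [left|right].
  + have [okG' nF'] := ok_old ok' SF'; split=> [h|[_ /(_ F SF)//]].
    by case: vQ; apply/(phiQ _ _ okG')/h/sub_conv; right.
  + have [okG nF] := ok_old ok SF; have [okG' nF' okFS' sub'] := ok_new ok' SF'.
    have [fG' _] := sub_face subQ okG'; have [fH HQ] := sub_face subQ okFS'.
    have -> : G `<=` G' /\ S `<=` S' <-> G `<=` G' /\ S `<=` S' `\ F.
      split=> -[GG' SS']; split=> // X SX; last by case: (SS' X SX).
      by split; [apply: SS'|move=> XF; rewrite XF in SX].
    rewrite -(sub_le subQ okG okG'); split=> h x Gx.
      apply: (stellar_join_old m0 pQ fQ bv fG' fH HQ (sub_F okFS') sub').
        exact: phiQ Gx.
      exact: h.
    by apply: sub_conv; left; apply: h.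
  + have [okG nF] := ok_old ok SF; have [okG' nF'] := ok_old ok' SF'.
    exact: (sub_le subQ okG okG').
- move=> G ok; case: asboolP => // SF; apply: (sub_old subQ).
  by have [] := ok_old ok SF.
Qed.

End Step.

Fixpoint admissible U (Fs : seq vset) : Prop :=
  if Fs is F :: Fs' then
    [/\ [/\ face K F, F !=set0 & F <> K], ~ U F,
      forall G, face K G -> G <> K -> F `<=` G -> G <> F -> U G,
      forall X, U X -> ~ X `<=` F & admissible (U `|` [set F]) Fs']
  else True.

(** Existence and structure go together: the next new vertex exists because the structure found so
    far shows that [F] is still a proper face. *)
Lemma subdivided_seq Fs U Q phi : admissible U Fs -> subdivided U Q phi ->
  (exists D, stellar_subdivisions Q Fs D) /\
  (forall D, stellar_subdivisions Q Fs D ->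
    exists phi', subdivided (U `|` [set` Fs]) D phi').
Proof.
elim: Fs U Q phi => [|F Fs IH] U Q phi /=.
  move=> _ subQ; split=> [|_ ->]; first by exists Q.
  by exists phi; rewrite (_ : [set` [::]] = set0) ?setU0 //; apply/seteqP; split.
move=> [[fF F0 FK] UF up down adm] subQ.
have [fQF FQ] := next_face subQ fF FK UF.
have pQ := sub_polytope subQ; have fQ := sub_full subQ.
have FsE : U `|` [set` F :: Fs] = (U `|` [set F]) `|` [set` Fs].
  rewrite -setUA; congr (_ `|` _); apply/seteqP; split=> X /=; rewrite inE.
    by move=> /orP[/eqP|]; [left|right].
  by move=> [->|->]; rewrite ?eqxx ?orbT.
have step v : beyond Q F v -> exists phi', subdivided (U `|` [set F]) (conv (Q `|` [set v])) phi'.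
  move=> /(beyond_beyond_ineq pQ fQ (face_sub fQF)) bv.
  by eexists; exact: (subdivided_step subQ fF F0 FK UF up down bv).
split.
  have [v bv] := beyond_exists m0 pQ fQ fQF F0.
  have [phi' sub'] := step v bv.
  have [[D hD] _] := IH _ _ _ adm sub'.
  exists D, (conv (Q `|` [set v])) => //; split=> //; last by exists v.
  by apply/eqP/set0P.
move=> D [Q1 [_ _ _ [v bv ->]] hD]; have [phi' sub'] := step v bv.
by rewrite FsE; apply: (IH _ _ _ adm sub').2.
Qed.

Lemma admissible_sorted B U Fs :
  let good X := [/\ face K X, X <> K & ~ X `<=` B] in
  uniq Fs -> sorted (fun F G => aff_dim G <= aff_dim F) Fs ->
  (forall F, F \in Fs -> good F /\ ~ U F) ->
  (forall X, U X -> good X /\ forall F, F \in Fs -> aff_dim F <= aff_dim X) ->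
  (forall X, good X -> U X \/ X \in Fs) -> admissible U Fs.
Proof.
move=> good; have good0 X : good X -> X !=set0.
  by move=> [_ _ XB]; apply: contrapT => X0; apply: XB => x Xx; case: X0; exists x.
elim: Fs U => [//|F Fs IH] U /= /andP[FFs uFs] srt hFs hU hgood.
have tr : transitive (fun F G : vset => aff_dim G <= aff_dim F).
  by move=> Y X Z h1 h2; apply: le_trans h2 h1.
have /allP minF := order_path_min tr srt.
have [[fF FK FB] nUF] := hFs F (mem_head _ _).
have F0 := good0 F (And3 fF FK FB).
split=> //.
(* A face above [F] is again not inside [B], so it is listed or already in [U]; its larger dimension
   prevents it from coming after [F]. *)
- move=> G fG GK FG GF; case: (hgood G) => [|//|].
    by split=> // GB; apply: FB => x /FG/GB.
  rewrite inE => /orP[/eqP//|/minF /=].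
  by rewrite leNgt (aff_dim_face_lt pK fF fG F0 FG) // => FG'; apply: GF.
- move=> X UX XF; have [gX /(_ F (mem_head _ _))] := hU X UX; have [fX _ _] := gX.
  rewrite leNgt (aff_dim_face_lt pK fX fF (good0 X gX) XF) // => XF'.
  by apply: nUF; rewrite -XF'.
- apply: IH => // [|G GFs|X [/hU[gX le]|->]|X /hgood].
  + exact: path_sorted srt.
  + have [gG nUG] := hFs G (mem_behead (s := F :: Fs) GFs); split=> // -[//|GF].
    by move: FFs; rewrite -GF GFs.
  + by split=> // G GFs; apply: le; rewrite inE GFs orbT.
  + by split=> // G GFs; apply: minF.
  + rewrite inE => -[UX|/orP[/eqP ->|XFs]]; [by left; left|by left; right|by right].
Qed.

(** A face is the hull of the generators it contains, so there are finitely many. *)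
Lemma faces_finite (P : vset -> Prop) :
  exists L : seq vset, forall X, X \in L <-> face K X /\ P X.
Proof.
case: pK => s eK.
pose key X := [ffun i : 'I_(size s) => `[< X s`_i >]].
have [L [Lf LP]] := finite_reps key (fun X => face K X /\ P X).
exists L => X; split=> [/Lf//|fPX]; have [X' X'L /ffunP e] := LP X fPX.
suff <- : X' = X by [].
have h Y : face K Y -> Y = conv [set x | x \in s /\ Y x].
  move=> [l [b [vl eY]]]; rewrite {1}eY eK conv_face -?eK; last first.
    by move=> x sx; apply: vl; rewrite eK; apply: sub_conv.
  congr conv; apply/seteqP; split=> x [xs].
    by move=> lx; split=> //; rewrite eY; split=> //; rewrite eK; apply: sub_conv.
  by rewrite eY => -[].
have eX x : x \in s -> X' x <-> X x.
  move=> xs; have ix : (index x s < size s)%N by rewrite index_mem.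
  have := e (Ordinal ix); rewrite !ffunE /= nth_index // => ex.
  by split=> /asboolP; [rewrite ex|rewrite -ex] => /asboolP.
rewrite (h X'); last by case: (Lf _ X'L).
rewrite [RHS]h; last by case: fPX.
by congr conv; apply/seteqP; split=> x [xs Xx]; split=> //; apply/eX.
Qed.

End Subdivisions.

(** * The face poset of the subdivided pyramid *)

Section Translate.
Context {R : realFieldType} {m : nat}.
Implicit Types (A Q F G : set 'rV[R]_m) (a : 'rV[R]_m).

Lemma translateK A a : translate (translate A a) (- a) = A.
Proof.
apply/seteqP; split=> [_ [_ [x Ax <-] <-]|x Ax]; first by rewrite opprK subrK.
by exists (x - a); [exists x|rewrite opprK subrK].
Qed.

Lemma translate_sub A G a : translate A a `<=` translate G a <-> A `<=` G.
Proof.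
split=> [AG x Ax|AG _ [x Ax <-]]; last by exists x => //; apply: AG.
by have [|y Gy /addIr <-] // := AG (x - a); exists x.
Qed.

Lemma translate_face Q F a : face Q F -> face (translate Q a) (translate F a).
Proof.
move=> [l [b [vl ->]]]; exists l, (b - dot l a).
split=> [_ [x /vl lx <-]|]; first by rewrite dotDr dotNr lerB.
apply/seteqP; split=> [_ [x [Qx /= lx] <-]|_ [[x Qx <-] /=]].
  by split; [exists x|rewrite /= dotDr dotNr lx].
by rewrite dotDr dotNr => /addIr lx; exists x.
Qed.

Lemma polytope_translate Q a : polytope Q -> polytope (translate Q a).
Proof.
apply: polytope_image => k c p c1.
under [RHS]eq_bigr do rewrite scalerBr.
by rewrite sumrB -scaler_suml c1 scale1r.
Qed.

End Translate.

Section FacePosetLemmas.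
Context {R : realFieldType} {m : nat} (Q : set 'rV[R]_m).

Lemma face_setP (F : face_poset Q) : face Q F.
Proof. by case: F => F /= /asboolP. Qed.

Lemma face_leP (F G : face_poset Q) : (F <= G)%O <-> (F : set _) `<=` G.
Proof. by rewrite -Order.le_val subsetEset. Qed.

Lemma face_set_inj (F G : face_poset Q) : (F : set _) = G -> F = G.
Proof. exact: val_inj. Qed.

End FacePosetLemmas.

Lemma poset_iso_mono_surj {d d' : Order.disp_t} (S : porderType d) (T : porderType d')
    (f : S -> T) :
  {mono f : x y / (x <= y)%O} -> (forall y, exists x, f x = y) -> poset_iso S T.
Proof.
move=> fm fs; exists f => //; have /choice[g gK] := fs.
exists g => // x; apply/le_anti.
by rewrite -!fm gK lexx.
Qed.

Lemma sorted_le_total {d : Order.disp_t} {T : porderType d} (s : seq T) :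
  sorted <=%O%O s -> {in s &, total <=%O%O}.
Proof.
elim: s => // x s IH /= ps; have /allP xs := order_path_min le_trans ps.
move=> y z; rewrite !inE => /orP[/eqP ->|ys] /orP[/eqP ->|zs].
- by rewrite lexx.
- by rewrite [(x <= z)%O]xs.
- by rewrite [(x <= y)%O]xs ?orbT.
- exact: IH (path_sorted ps) _ _ ys zs.
Qed.

Lemma sorted_le_last {d : Order.disp_t} {T : porderType d} (x : T) (s : seq T) z :
  sorted <=%O%O s -> z \in s -> (z <= last x s)%O.
Proof.
elim: s x => // y s IH x /= ps; rewrite inE => /orP[/eqP ->|zs]; last first.
  exact: IH (path_sorted ps) zs.
have /allP ys := order_path_min le_trans ps.
by have := mem_last y s; rewrite inE => /orP[/eqP ->|/ys].
Qed.

Section DStell.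
Context {R : realFieldType} {n : nat}.
Variable Q : set 'rV[R]_n.
Hypotheses (pQ : polytope Q) (fQ : full Q) (Q0 : Q !=set0).

Definition subdivided_faces apex : set (set 'rV[R]_(n + 1)) := [set F |
  [/\ face (pyr Q apex) F, F <> pyr Q apex & ~ F `<=` pyr_base Q]].

Let n0 : (0 < n + 1)%N. Proof. by rewrite addn1. Qed.

Lemma DStell_seq apex Fs : ~ aff (pyr_base Q) apex -> uniq Fs ->
  (forall F, F \in Fs <->
          [/\ face (pyr Q apex) F, F <> pyr Q apex & ~ F `<=` pyr_base Q]) ->
  sorted (fun F G => aff_dim G <= aff_dim F) Fs ->
  (exists D, stellar_subdivisions (pyr Q apex) Fs D) /\
  forall D, stellar_subdivisions (pyr Q apex) Fs D ->
  exists phi, subdivided (pyr Q apex) (subdivided_faces apex) D phi.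
Proof.
move=> apexP uFs FsP srt.
have pK := polytope_pyr apex pQ; have fK := full_pyr pQ fQ Q0 apexP.
have adm : admissible (pyr Q apex) set0 Fs.
  apply: (@admissible_sorted _ _ _ pK (pyr_base Q)) => // [F /FsP gF|X gX].
    by split=> // -[].
  by right; apply/FsP.
have [exD DP] := subdivided_seq n0 adm (subdivided0 pK fK).
split=> // D /DP; rewrite set0U (_ : [set` Fs] = subdivided_faces apex) //.
by apply/seteqP; split=> X /FsP.
Qed.

Lemma DStell_subdivided D : is_DStell Q D -> exists apex phi,
  ~ aff (pyr_base Q) apex /\ subdivided (pyr Q apex) (subdivided_faces apex) D phi.
Proof.
move=> [apex [Fs [apexP uFs FsP srt hD]]].
have [phi subD] := (DStell_seq apexP uFs FsP srt).2 D hD.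
by exists apex, phi.
Qed.

Lemma DStell_exists : exists D, is_DStell Q D.
Proof.
pose apex : 'rV[R]_(n + 1) := row_mx 0 (const_mx 1).
have apexP : ~ aff (pyr_base Q) apex.
  (* The functional [dot apex] vanishes on the base but is 1 at the apex. *)
  move=> /(@eq_dot_aff _ _ _ apex 0) h; have := h _.
  rewrite dot_row_mx dot0l dot_scalar mxE mulr1 add0r => /(_ _)/eqP.
  rewrite oner_eq0 => H; suff : false by []; apply: H => _ [x _ <-].
  by rewrite dot_row_mx dot0l dot0r addr0.
have [L LP] := faces_finite (polytope_pyr apex pQ)
  (fun F => F <> pyr Q apex /\ ~ F `<=` pyr_base Q).
pose r := fun F G : set 'rV[R]_(n + 1) => aff_dim G <= aff_dim F.
pose Fs := sort r (undup L).
have uFs : uniq Fs by rewrite sort_uniq undup_uniq.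
have FsP F : F \in Fs <-> [/\ face (pyr Q apex) F, F <> pyr Q apex & ~ F `<=` pyr_base Q].
  by rewrite mem_sort mem_undup LP; split=> [[? []]|[]].
have srt : sorted r Fs.
  by apply: sort_sorted => F G; rewrite /r orbC le_total.
have [[D hD] _] := DStell_seq apexP uFs FsP srt.
by exists D, apex, Fs.
Qed.

End DStell.

(** * The isomorphism with the stellahedral transform *)

Section Isomorphism.
Context {R : realFieldType} {n : nat}.
Variables (P : set 'rV[R]_n) (a : 'rV[R]_n).
Hypotheses (pP : polytope P) (aP : absorbing (translate P a)).

Let A := translate P a.
Let B := polar A.
Let pA : polytope A. Proof. exact: polytope_translate. Qed.
Let pB : polytope B. Proof. exact: polytope_polar. Qed.
Let aB : absorbing B. Proof. exact: absorbing_polar. Qed.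
Let fB : full B. Proof. exact: absorbing_full. Qed.
Let B0 : B !=set0. Proof. by exists 0; apply: absorbing0. Qed.

Definition polar_face (F : face_poset P) := dual_face A (translate F a).
Local Notation E := polar_face.

Lemma polar_faceP F : face B (E F).
Proof. exact/face_dual_face/translate_face/face_setP. Qed.

Lemma polar_face_sub F G : E F `<=` E G <-> (G <= F)%O.
Proof.
rewrite face_leP -(translate_sub G F a); split=> [|h]; last exact: dual_face_anti.
move=> /(@dual_face_anti _ _ B).
by rewrite /E !dual_faceK //; apply/translate_face/face_setP.
Qed.

Lemma polar_face_surj G : face B G -> exists F, E F = G.
Proof.
move=> fG; have fF : face P (translate (dual_face B G) (- a)).
  rewrite -[P](translateK _ a); apply: translate_face.
  by rewrite -[translate P a](polarK pA aP); apply: face_dual_face.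
exists (FacePoset (asboolT fF)); rewrite /E /= -{2}(opprK a) translateK.
by rewrite -[RHS](dual_faceK pB aB fG) /B (polarK pA aP).
Qed.

Lemma polar_face_bot : E \bot%O = B.
Proof.
apply/seteqP; split=> [|y By]; first exact: (face_sub (polar_faceP _)).
by split=> // x [].
Qed.

Variables (D : set 'rV[R]_(n + 1)) (apex : 'rV[R]_(n + 1)).
Variable phi : set 'rV[R]_(n + 1) -> set (set 'rV[R]_(n + 1)) -> set 'rV[R]_(n + 1).
Hypothesis apexP : ~ aff (pyr_base B) apex.
Hypothesis subD : subdivided (pyr B apex) (subdivided_faces B apex) D phi.

Definition cone_face F := join_apex apex (E F).

(** The bottom of the chain is dropped: its cone is the whole pyramid, which is not a proper
    face. *)
Definition chain_faces (c : seq (face_poset P)) : set (set 'rV[R]_(n + 1)) :=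
  [set X | exists F, [/\ F \in c, F != \bot%O & X = cone_face F]].

Lemma cone_face_sub F G : cone_face F `<=` cone_face G <-> (G <= F)%O.
Proof.
rewrite -polar_face_sub; exact: (join_apex_sub pB fB B0 apexP _ (polar_faceP G)).
Qed.

Lemma cone_face_inj F G : cone_face F = cone_face G -> F = G.
Proof. by move=> e; apply/le_anti/andP; split; apply/cone_face_sub; rewrite e. Qed.

Lemma cone_face_bot : cone_face \bot%O = pyr B apex.
Proof. by rewrite /cone_face polar_face_bot. Qed.

Lemma cone_face_subdivided F : F != \bot%O -> subdivided_faces B apex (cone_face F).
Proof.
move=> F0; split.
- exact/pyr_face_join/polar_faceP.
- by rewrite -cone_face_bot => /cone_face_inj/eqP; apply/negP.
- by move=> sub; apply/(apex_notin apexP)/sub/join_apex_apex.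
Qed.

Lemma subdivided_cone_face X : subdivided_faces B apex X ->
  exists2 F, F != \bot%O & X = cone_face F.
Proof.
move=> [fX XK XB]; have [G fG [eX|eX]] := pyr_faceP pB fX.
  by case: XB; rewrite eX; apply/pyr_base_sub; exact: face_sub.
have [F eF] := polar_face_surj fG; exists F; last by rewrite /cone_face eF.
by apply/eqP => F0; apply: XK; rewrite eX -eF F0 -cone_face_bot.
Qed.

(** Polarity reverses the order, so [y] lying above the chain places the base face [E y] inside each
    cone of the chain. *)
Lemma stell_flag_pair c y : stell_pair (c, y) ->
  flag_pair (pyr B apex) (subdivided_faces B apex) (pyr_base (E y)) (chain_faces c).
Proof.
move=> /and3P[_ /=]; rewrite lt_sorted_uniq_le => /andP[_ sc] cy.
have zy z : z \in c -> (z <= y)%O.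
  by move=> /(sorted_le_last \bot%O sc) zl; apply: le_trans cy.
split.
- split; first exact/pyr_face_base/polar_faceP.
  move=> e; have [x Ex xE] : pyr_base (E y) apex by rewrite e; apply: sub_conv; right.
  by apply: (apex_notin apexP); exists x => //; exact: (face_sub (polar_faceP y)).
- by move=> [_ _]; apply; apply/pyr_base_sub; exact: (face_sub (polar_faceP _)).
- by move=> _ [F [_ F0 ->]]; apply: cone_face_subdivided.
- move=> _ _ [F [Fc _ ->]] [G [Gc _ ->]].
  by have /orP[] := sorted_le_total sc Fc Gc; [right|left]; apply/cone_face_sub.
- move=> _ [F [Fc _ ->]]; apply/(pyr_base_join pB fB B0 apexP _ (polar_faceP F)).
  exact/polar_face_sub/zy.
Qed.

Definition stell_set (s : Stell (face_poset P)) : set 'rV[R]_(n + 1) :=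
  if s is Some cy then phi (pyr_base (E (val cy).2)) (chain_faces (val cy).1) else D.

Lemma stell_set_face s : face D (stell_set s).
Proof.
case: s => [[[c y] /= cyP]|] /=; first by case: (sub_face subD (stell_flag_pair cyP)).
exists 0, 0; split=> [x _|]; rewrite ?dot0l //; apply/seteqP; split=> x => [Dx|[]//].
by split=> //=; rewrite dot0l.
Qed.

(** As [c'] contains the bottom, dropping it from the chains loses no information. *)
Lemma chain_faces_sub c c' : \bot%O \in c' ->
  chain_faces c `<=` chain_faces c' <-> all [in c'] c.
Proof.
move=> bc'; split=> [cc'|/allP cc' _ [F [/cc' Fc' F0 ->]]]; last by exists F.
apply/allP => F Fc; have [->//|F0] := eqVneq F \bot%O.
by have [|G [Gc' _ /cone_face_inj ->]] := cc' (cone_face F); first by exists F.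
Qed.

Lemma stell_set_le s t : stell_set s `<=` stell_set t <-> (s <= t)%O.
Proof.
case: s => [[[c y] cyP]|]; case: t => [[[c' y'] cyP']|] /=; last 3 first.
- have ok := stell_flag_pair cyP; have [fX XD] := sub_face subD ok.
  by split=> // _; apply: face_sub.
- have ok := stell_flag_pair cyP'; have [fX XD] := sub_face subD ok.
  by split=> // DX; case: XD; apply/seteqP; split=> //; apply: face_sub.
- by split=> // _ x.
rewrite (sub_le subD (stell_flag_pair cyP) (stell_flag_pair cyP')).
rewrite pyr_base_sub polar_face_sub chain_faces_sub; last first.
  by case/and3P: cyP' => /= /eqP; case: c' => // x c' [->] _ _; rewrite mem_head.
rewrite -[X in _ <-> X]/(is_true (all [in c'] c && (y' <= y)%O)).
by split=> [[-> ->]|/andP[-> ->]].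
Qed.

Lemma flag_pair_stell G S :
  flag_pair (pyr B apex) (subdivided_faces B apex) G S ->
  exists c y, [/\ stell_pair (c, y), G = pyr_base (E y) & S = chain_faces c].
Proof.
move=> [[fG GK] nUG SU cS GS].
(* A proper face containing the apex has been subdivided, so [G] lies in the base. *)
have [G0 fG0 [eG|eG]] := pyr_faceP pB fG; last first.
  case: nUG; split=> // sub; apply/(apex_notin apexP)/sub.
  by rewrite eG; apply: join_apex_apex.
have [y ey] := polar_face_surj fG0.
(* The set [S] becomes a sequence by filtering the finite list of faces of [P] and sorting it, with
   the bottom put in front. *)
have [L LP] := faces_finite pP (fun=> True).
pose zs := [seq F <- undup (pmap insub L : seq (face_poset P)) |
  (F != \bot%O) && `[< S (cone_face F) >]].
have zsP F : F \in zs <-> F != \bot%O /\ S (cone_face F).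
  rewrite mem_filter mem_undup mem_pmap_sub.
  have -> : val F \in L by apply/LP; split=> //; apply: face_setP.
  by rewrite andbT; split=> [/andP[-> /asboolP]|[-> /asboolP ->]].
pose c := \bot%O :: sort <=%O%O zs.
have cP F : F \in c <-> F = \bot%O \/ F \in zs.
  by rewrite inE mem_sort; split=> [/orP[/eqP|]|[->|->]]; rewrite ?eqxx ?orbT; auto.
exists c, y; split; last first.
- apply/seteqP; split=> [X SX|_ [F [/cP[->|/zsP[_ SF]] F0 ->]]] //.
    have [F F0 eX] := subdivided_cone_face (SU X SX); exists F; split=> //.
    by apply/cP; right; apply/zsP; rewrite -eX.
  by rewrite eqxx in F0.
- by rewrite eG ey.
apply/and3P; split=> //=.
  rewrite -[path _ _ _]/(sorted <%O%O c) lt_sorted_uniq_le /= path_sortedE; last exact: le_trans.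
  rewrite mem_sort sort_uniq filter_uniq ?undup_uniq // andbT.
  apply/and3P; split.
  - by apply/negP => /zsP[]; rewrite eqxx.
  - by apply/allP => F _; apply: le0x.
  (* Faces of [P] are only partially ordered, but members of [zs] are comparable because their cones
     form a chain. *)
  - apply: (@sort_sorted_in _ (mem zs)); last exact/allP.
    move=> F G' /zsP[_ SF] /zsP[_ SG'].
    by have [/cone_face_sub ->|/cone_face_sub ->] := cS _ _ SF SG'; rewrite ?orbT.
have /cP[->|/zsP[_ SF]] := mem_last \bot%O (sort <=%O%O zs); first exact: le0x.
apply/polar_face_sub; rewrite ey; apply/(pyr_base_join pB fB B0 apexP) => //.
  exact: polar_faceP.
by rewrite -eG; apply: GS.
Qed.

Lemma stell_set_surj X : face D X -> exists s, stell_set s = X.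
Proof.
move=> fX; have [->|XD] := pselect (X = D); first by exists None.
have [G [S [ok ->]]] := sub_surj subD fX XD.
have [c [y [cyP -> ->]]] := flag_pair_stell ok.
by exists (Some (exist _ (c, y) cyP)).
Qed.

Lemma stell_iso : poset_iso (Stell (face_poset P)) (face_poset D).
Proof.
apply: (@poset_iso_mono_surj _ _ _ _ (fun s => FacePoset (asboolT (stell_set_face s)))).
  by move=> s t; apply/idP/idP => [/face_leP /stell_set_le//|st]; apply/face_leP/stell_set_le.
move=> X; have [s es] := stell_set_surj (face_setP X).
by exists s; apply: face_set_inj.
Qed.

End Isomorphism.

Lemma interior_absorbing (R : realType) (n : nat) (P : set 'rV[R]_n) (a : 'rV[R]_n) :
  interior P a -> absorbing (translate P a).
Proof.
rewrite /interior => /nbhs_ballP[e /= e0 eP] u.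
(* [s] strictly exceeds every [|u 0 j|], so [e / s] scales [u] into the ball, which is measured
   entrywise. *)
pose s := 1 + \sum_j `|u 0 j|.
have s0 : 0 < s by rewrite ltr_wpDr // sumr_ge0.
exists (e / s); first by rewrite divr_gt0.
exists (a + (e / s) *: u); last by rewrite addrC addKr.
apply: eP; split=> // i j; rewrite !mxE /ball /= opprD addrA subrr add0r normrN normrM.
rewrite gtr0_norm ?divr_gt0 // mulrAC ltr_pdivrMr // ltr_pM2l // (ord1 i).
by rewrite /s (bigD1 j) //= addrCA ltrDl ltr_pwDl // sumr_ge0.
Qed.

Unset Implicit Arguments.

(** [is_DStell] is a relation: a [D] is shown to exist, and the isomorphism holds for every [D],
    whatever the apex, the order within a dimension and the new vertices. *)
Theorem theorem1p3 (R : realType) (n : nat) (P : set 'rV[R]_n)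
    (a : 'rV[R]_n) :
  polytope P -> aff_dim P = n%:Z -> interior P a ->
  (exists D, is_DStell (polar (translate P a)) D) /\
  (forall D, is_DStell (polar (translate P a)) D ->
     poset_iso (Stell (face_poset P)) (face_poset D)).
Proof.
move=> pP _ /interior_absorbing aP.
have pA := polytope_translate a pP.
have pB := polytope_polar pA aP; have aB := absorbing_polar pA aP.
have fB := absorbing_full aB.
have B0 : polar (translate P a) !=set0 by exists 0; apply: absorbing0.
split; first exact: DStell_exists.
move=> D /(DStell_subdivided pB fB B0)[apex [phi [apexP subD]]].
exact: (stell_iso pP aP apexP subD).
Qed.
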